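(* $$K(M_{n,\lfloor n/2\rfloor},F_{\mathrm{nb}},G_{\mathrm{nb}})\,[\![(\forall X)(\forall m)(\exists x_1)(\exists x_2)\,\varphi_{\mathrm{WeakPigeon}}(X,m,x_1,x_2)]\!]=\mathbf 0,$$ where $\varphi_{\mathrm{WeakPigeon}}(X,m,x_1,x_2)$ is the formula $$(m=0)\vee\big(|x_1|<|m|\wedge|x_2|<|m|\wedge\big[(|X(x_1)|\ge|m|-1)\vee(|X(x_2)|\ge|m|-1)\vee(x_1\ne x_2\wedge X(x_1)=X(x_2))\big]\big).$$
   Context: Setup. $L_{all}$ is the first-order language with a name for every relation and function on $\mathbb N$. Fix an $\aleph_1$-saturated nonstandard model $\mathcal M$ of the true theory $\mathrm{Th}_{L_{all}}(\mathbb N)$, with $\mathbb N\subseteq\mathcal M$ as an initial segment, and a nonstandard number $n\in\mathcal M\setminus\mathbb N$ which is a power of two. Finite sets, functions, sequences and trees are coded by numbers; for a coded set $S$, $|S|\in\mathcal M$ is its cardinality, while for a number $m$ (in particular in the formula of the claim) $|m|$ is its bit length. Any sequence of standard finite objects has a value at index $n$ in $\mathcal M$ (via the corresponding function symbol of $L_{all}$). $\mathrm{st}$ is the standard part of finite $\mathcal M$-rationals; an $\mathcal M$-rational $q$ is infinitesimal if $|q|<1/k$ for all standard $k\ge1$. $\mathcal M_n\subseteq\mathcal M$ is the set of numbers bounded above by $2^{n^{1/t}}$ for some $t\in\mathcal M\setminus\mathbb N$. $L_n\subseteq L_{all}$ consists of all relation symbols and all function symbols whose values on tuples from $\mathcal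 M_n$ lie in $\mathcal M_n$; $\mathcal M_n$ is regarded as an $L_n$-structure. The language $L_n^2$ extends $L_n$ (number sort) by set-sort variables $X,Y,\dots$ standing for functions of finite arity on the number sort, which can be applied to number terms to form number terms, and by equality for the set sort. An expression $X(\overline x)$ used as a formula abbreviates $X(\overline x)\ne0$. $\langle i,j\rangle$ is a pairing function on $\mathcal M_n$. Sample space. $M_{k,\lfloor k/2\rfloor}$ is the set of all $\{E\}$-structures on $\{0,\dots,k-1\}$ in which $E$ is the graph of a function from $\{0,\dots,k-1\}$ to $\{0,\dots,\lfloor k/2\rfloor-1\}$; $M_{n,\lfloor n/2\rfloor}$ is its value at index $n$. For $\omega\in M_{n,\lfloor n/2\rfloor}$ the neighbor of $i<n$ in $\omega$ is the image of $i$ under the function whose graph is $\omega$. Boolean algebra. $\mathcal A$ is the algebra of subsets of $M_{n,\lfloor n/2\rfloor}$ coded in $\mathcal M$, $\mathcal I$ the ideal of those $A$ with $|A|/|M_{n,\lfloor n/2\rfloor}|$ infinitesimal, and $\mathcal B=\mathcal A/\mathcal I$, a complete Boolean algebra with least element $\mathbf 0$, greatest element $\mathbf 1$ and measure $\mu(A/\mathcal I)=\mathrm{st}(|A|/|M_{n,\lfloor n/2\rfloor}|)$. Trees. $\mathcal T_{\mathrm{nb}}$ is the set of all labeled rooted trees coded in $\mathcal M$ such that: each non-leaf node is labeled by some $v\in\{0,\dots,n-1\}$ and has for each $u\in\{0,\dots,n-1\}$ an outgoing edge labeled $u$; each leaf is labeled by an element of $\mathcal M_n$; the depth is at most $n^{1/t}$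 (rounded) for some $t\in\mathcal M\setminus\mathbb N$. The computation of $T$ on $\omega$ starts at the root and at a node labeled $v$ follows the edge labeled by the neighbor of $v$ in $\omega$ until a leaf is reached; its label is $T(\omega)$. $F_{\mathrm{nb}}$ is the set of all functions on $M_{n,\lfloor n/2\rfloor}$ computed by trees in $\mathcal T_{\mathrm{nb}}$. Random functions. A $k$-ary random function $\Theta$ assigns to each $\omega$ a $k$-ary function $\Theta_\omega$ coded in $\mathcal M$ with arguments from a domain of $k$-tuples from $\mathcal M_n$ and values in $\mathcal M_n$; for $\alpha_0,\dots,\alpha_{k-1}\in F_{\mathrm{nb}}$, $\Theta(\alpha_0,\dots,\alpha_{k-1})$ is the function $\omega\mapsto\Theta_\omega(\alpha_0(\omega),\dots,\alpha_{k-1}(\omega))$, with value $0$ when the arguments are outside the domain. $G_{\mathrm{nb}}$ is the family of all random functions on $M_{n,\lfloor n/2\rfloor}$ such that: for each unary $\Theta\in G_{\mathrm{nb}}$ there is a tuple $(\gamma_0,\dots,\gamma_{m-1})$, $m\in\mathcal M_n$, coded by an element of $\mathcal M$, with all $\gamma_i\in F_{\mathrm{nb}}$ and, for all $\alpha\in F_{\mathrm{nb}}$, $\Theta(\alpha)(\omega)=\gamma_{\alpha(\omega)}(\omega)$ if $\alpha(\omega)<m$ and $0$ otherwise; for each $k$-ary $\Theta\in G_{\mathrm{nb}}$, $k>1$, there is a $(k-1)$-ary $\Theta'\in G_{\mathrm{nb}}$ with $\Theta(\alpha_0,\dots,\alpha_{k-1})=\Theta'(\alpha_0,\dots,\alpha_{k-3},\langle\alpha_{k-2},\alpha_{k-1}\rangle)$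 for all $\alpha_i\in F_{\mathrm{nb}}$. The structure $K=K(M_{n,\lfloor n/2\rfloor},F_{\mathrm{nb}},G_{\mathrm{nb}})$ is the $\mathcal B$-valued $L_n^2$-structure with number sort $F_{\mathrm{nb}}$ and set sort $G_{\mathrm{nb}}$ (function symbols of $L_n$ act pointwise in $\omega$, a $k$-ary $\Theta\in G_{\mathrm{nb}}$ sends $\alpha_0,\dots,\alpha_{k-1}\in F_{\mathrm{nb}}$ to the function $\omega\mapsto\Theta_\omega(\alpha_0(\omega),\dots,\alpha_{k-1}(\omega))$, with value $0$ at those $\omega$ where the arguments are outside the domain of $\Theta_\omega$, so terms evaluate to elements of $F_{\mathrm{nb}}$) and truth values: $[\![\alpha=\beta]\!]=\{\omega:\alpha(\omega)=\beta(\omega)\}/\mathcal I$; $[\![R(\alpha_0,\dots,\alpha_{k-1})]\!]=\{\omega:\mathcal M_n\models R(\alpha_0(\omega),\dots,\alpha_{k-1}(\omega))\}/\mathcal I$ for relation symbols $R\in L_n$; $[\![\Theta=\Xi]\!]=\{\omega:\Theta_\omega=\Xi_\omega\}/\mathcal I$; $[\![-]\!]$ commutes with $\neg,\wedge,\vee$; $\forall x,\exists x$ are interpreted by $\bigwedge_{\alpha\in F_{\mathrm{nb}}},\bigvee_{\alpha\in F_{\mathrm{nb}}}$ and $\forall X,\exists X$ by $\bigwedge_{\Theta\in G_{\mathrm{nb}}},\bigvee_{\Theta\in G_{\mathrm{nb}}}$ (over $\Theta$ of the appropriate arity; here $X$ is unary). *)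

(* Defs.v *)
Set Warnings "-notation-overridden,-redundant-canonical-projection".
From HB Require Import structures.
From mathcomp Require Import all_boot all_order.
From mathcomp Require Import generic_quotient boolp classical_sets.

Set Implicit Arguments.
Unset Strict Implicit.
Unset Printing Implicit Defensive.

Import Order.Theory.
Local Open Scope quotient_scope.
Local Open Scope classical_set_scope.

(* The function symbols of [L_all] are the functions on nat and its relation
   symbols are the relations on nat, of every finite arity. *)
Record Lall_structure := LallStructure {
  carrier :> Type;
  interp_fun : forall k, (k.-tuple nat -> nat) -> k.-tuple carrier -> carrier;
  interp_rel : forall k, set (k.-tuple nat) -> set (k.-tuple carrier) }.

Definition standard_model : Lall_structure :=
  @LallStructure nat (fun k f => f) (fun k R => R).

Inductive Lall_term (k : nat) : Type :=
| AVar of 'I_k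
| AFun j (f : j.-tuple nat -> nat) of ('I_j -> Lall_term k).

(* [Lall_formula k]: formulas with free variables among [k]; a quantifier binds
   the variable [ord0]. *)
Inductive Lall_formula : nat -> Type :=
| AEq k of Lall_term k & Lall_term k : Lall_formula k
| ARel k j (R : set (j.-tuple nat)) of ('I_j -> Lall_term k) : Lall_formula k
| ANot k of Lall_formula k : Lall_formula k
| AAnd k of Lall_formula k & Lall_formula k : Lall_formula k
| AOr k of Lall_formula k & Lall_formula k : Lall_formula k
| AImp k of Lall_formula k & Lall_formula k : Lall_formula k
| AAll k of Lall_formula k.+1 : Lall_formula k
| AEx k of Lall_formula k.+1 : Lall_formula k.

Fixpoint Lall_eval (M : Lall_structure) k (t : Lall_term k) (e : k.-tuple M) : M :=
  match t with
  | AVar i => tnth e i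
  | AFun j f ts => interp_fun f [tuple Lall_eval (ts i) e | i < j]
  end.

Fixpoint Lall_sat (M : Lall_structure) k (phi : Lall_formula k) :
    k.-tuple M -> Prop :=
  match phi with
  | AEq k t u => fun e => Lall_eval t e = Lall_eval u e
  | ARel k j R ts => fun e => interp_rel R [tuple Lall_eval (ts i) e | i < j]
  | ANot k f => fun e => ~ Lall_sat f e
  | AAnd k f g => fun e => Lall_sat f e /\ Lall_sat g e
  | AOr k f g => fun e => Lall_sat f e \/ Lall_sat g e
  | AImp k f g => fun e => Lall_sat f e -> Lall_sat g e
  | AAll k f => fun e => forall a : M, Lall_sat f [tuple of a :: e]
  | AEx k f => fun e => exists a : M, Lall_sat f [tuple of a :: e]
  end.

Definition models_true_arithmetic (M : Lall_structure) : Prop :=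
  forall phi : Lall_formula 0,
    @Lall_sat standard_model 0 phi [tuple] -> @Lall_sat M 0 phi [tuple].

(* A formula in one free variable [ord0], with parameters from [M]. *)
Record param_formula (M : Lall_structure) := ParamFormula {
  nparams : nat;
  pformula : Lall_formula nparams.+1;
  params : nparams.-tuple M }.

Definition realizes (M : Lall_structure) (p : param_formula M) (x : M) : Prop :=
  Lall_sat (pformula p) [tuple of x :: params p].

(* Every countable, finitely satisfiable set of formulas with parameters is
   realized. *)
Definition aleph1_saturated (M : Lall_structure) : Prop :=
  forall p : nat -> param_formula M,
    (forall l, exists x : M, forall i, i < l -> realizes (p i) x) ->
    exists x : M, forall i, realizes (p i) x.

(* Ackermann coding: [a] codes the set of the positions of its binary digits 1. *)
Definition nat_mem (x a : nat) : Prop := odd (a %/ 2 ^ x).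

Definition nat_card (a : nat) : nat :=
  size [seq x <- iota 0 a | odd (a %/ 2 ^ x)].

(* The code of [A], when [A] is finite. *)
Definition set_code (A : set nat) : nat :=
  xget 0 [set a | forall x, nat_mem x a <-> A x].

(* Cantor's pairing function. *)
Definition nat_pair (i j : nat) : nat := 'C((i + j).+1, 2) + j.

(* [w] codes the edge relation of an {E}-structure on {0, ..., k-1} in which E
   is the graph of a function from {0, ..., k-1} to {0, ..., l-1}. *)
Definition graph_structure (k l w : nat) : Prop :=
  exists f : {ffun 'I_k -> 'I_l},
    forall e, nat_mem e w <-> exists i : 'I_k, e = nat_pair i (f i).

Definition sample_space_code (k : nat) : nat :=
  set_code [set w | graph_structure k k./2 w].

Definition nat_neighbor (w i : nat) : nat :=
  xget 0 [set j | nat_mem (nat_pair i j) w].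

(* Labeled rooted trees are [GenTree.tree nat]: in [GenTree.Node v ts] the edge
   labeled [u] leads to the subtree [nth _ ts u]. *)
Notation nat_tree := (GenTree.tree nat).

Fixpoint neighbor_tree (k : nat) (t : nat_tree) : bool :=
  match t with
  | GenTree.Leaf _ => true
  | GenTree.Node v ts => [&& v < k, size ts == k & all (neighbor_tree k) ts]
  end.

Fixpoint tree_depth (t : nat_tree) : nat :=
  match t with
  | GenTree.Leaf _ => 0
  | GenTree.Node _ ts => (\max_(d <- map tree_depth ts) d).+1
  end.

Fixpoint tree_leaves (t : nat_tree) : seq nat :=
  match t with
  | GenTree.Leaf x => [:: x]
  | GenTree.Node _ ts => flatten (map tree_leaves ts)
  end.

Fixpoint tree_run (w : nat) (t : nat_tree) : nat :=
  match t with
  | GenTree.Leaf x => x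
  | GenTree.Node v ts => nth 0 (map (tree_run w) ts) (nat_neighbor w v)
  end.

Definition tree_of_code (c : nat) : option nat_tree := unpickle c.

Definition neighbor_tree_code (k c : nat) : Prop :=
  if tree_of_code c is Some t then neighbor_tree k t else False.
Definition tree_depth_code (c : nat) : nat := oapp tree_depth 0 (tree_of_code c).
Definition tree_leaf_code (c x : nat) : Prop :=
  x \in oapp tree_leaves [::] (tree_of_code c).
Definition tree_run_code (c w : nat) : nat := oapp (tree_run w) 0 (tree_of_code c).

(* A finite [k]-ary partial function is coded by the set of the codes of the
   sequences [rcons x y], where [x] is in the domain and [y] is its value. *)
Definition fun_code (k c : nat) : Prop :=
  (forall e, nat_mem e c -> size (CodeSeq.decode e) = k.+1) /\
  (forall x y z, nat_mem (CodeSeq.code (rcons x y)) c ->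
     nat_mem (CodeSeq.code (rcons x z)) c -> y = z).

(* The value is 0 outside the domain. *)
Definition fun_app (c : nat) (x : seq nat) : nat :=
  xget 0 [set y | nat_mem (CodeSeq.code (rcons x y)) c].

Definition seq_size (g : nat) : nat := size (CodeSeq.decode g).
Definition seq_nth (g i : nat) : nat := nth 0 (CodeSeq.decode g) i.

(* The [t]-th root of [k], rounded down (for [0 < t]). *)
Definition nat_root (k t : nat) : nat := \max_(r < k.+1 | r ^ t <= k) r.

(* The number of binary digits of [m], with [bit_length 0 = 0]. *)
Definition bit_length (m : nat) : nat := up_log 2 m.+1.

Definition sym1 (f : nat -> nat) (v : 1.-tuple nat) : nat := f (nth 0 v 0).
Definition sym2 (f : nat -> nat -> nat) (v : 2.-tuple nat) : nat :=
  f (nth 0 v 0) (nth 0 v 1).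
Definition rsym1 (R : nat -> Prop) : set (1.-tuple nat) :=
  fun v => R (nth 0 v 0).
Definition rsym2 (R : nat -> nat -> Prop) : set (2.-tuple nat) :=
  fun v => R (nth 0 v 0) (nth 0 v 1).
Definition app_sym k (v : k.+1.-tuple nat) : nat := fun_app (head 0 v) (behead v).
Definition graph_sym k : set (k.+1.-tuple nat) :=
  fun v => nat_mem (CodeSeq.code (behead v)) (head 0 v).

Section Interpretation.
Variable M : Lall_structure.

(* The embedding of the standard numbers into [M]. *)
Definition std (c : nat) : M := @interp_fun M 0 (fun=> c) [tuple].
Definition mfun1 (f : nat -> nat) (x : M) : M := interp_fun (sym1 f) [tuple x].
Definition mfun2 (f : nat -> nat -> nat) (x y : M) : M :=
  interp_fun (sym2 f) [tuple x; y].
Definition mrel1 (R : nat -> Prop) (x : M) : Prop :=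
  interp_rel (rsym1 R) [tuple x].
Definition mrel2 (R : nat -> nat -> Prop) (x y : M) : Prop :=
  interp_rel (rsym2 R) [tuple x; y].

Definition nonstandard (x : M) : Prop := forall c : nat, x <> std c.
Definition power_of_two : M -> Prop := mrel1 (fun x => exists m, x = 2 ^ m).
Definition mle : M -> M -> Prop := mrel2 (fun x y => x <= y).
Definition mlt : M -> M -> Prop := mrel2 (fun x y => x < y).
Definition mmem : M -> M -> Prop := mrel2 nat_mem.
Definition mcard : M -> M := mfun1 nat_card.
Definition mapp k (c : M) (x : k.-tuple M) : M :=
  interp_fun (@app_sym k) [tuple of c :: x].

(* The M-rational [a / b] (with [0 < b]) is infinitesimal. *)
Definition infinitesimal_ratio (a b : M) : Prop :=
  forall k : nat, 0 < k -> mlt (mfun2 muln (std k) a) b.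

End Interpretation.

Section Transfer.
Variable k : nat.
Implicit Types (t u : Lall_term k).

Definition tc (c : nat) : Lall_term k := @AFun k 0 (fun=> c) (tnth [tuple]).
Definition t1 f t : Lall_term k := @AFun k 1 (sym1 f) (tnth [tuple t]).
Definition t2 f t u : Lall_term k := @AFun k 2 (sym2 f) (tnth [tuple t; u]).
Definition r2 R t u : Lall_formula k := @ARel k 2 (rsym2 R) (tnth [tuple t; u]).

Lemma mktuple_tnth (T U : Type) j (f : T -> U) (t : j.-tuple T) :
  [tuple f (tnth t i) | i < j] = map_tuple f t.
Proof. by apply: eq_from_tnth => i; rewrite tnth_mktuple tnth_map. Qed.

Lemma eval_tc (M : Lall_structure) c (e : k.-tuple M) :
  Lall_eval (tc c) e = std M c.
Proof. by rewrite /= /std; congr interp_fun; apply: eq_from_tnth => -[]. Qed.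

Lemma eval_t1 (M : Lall_structure) f t (e : k.-tuple M) :
  Lall_eval (t1 f t) e = mfun1 f (Lall_eval t e).
Proof.
rewrite /= /mfun1 (mktuple_tnth (fun t => Lall_eval t e)).
by congr interp_fun; apply: val_inj.
Qed.

Lemma eval_t2 (M : Lall_structure) f t u (e : k.-tuple M) :
  Lall_eval (t2 f t u) e = mfun2 f (Lall_eval t e) (Lall_eval u e).
Proof.
rewrite /= /mfun2 (mktuple_tnth (fun t => Lall_eval t e)).
by congr interp_fun; apply: val_inj.
Qed.

Lemma sat_r2 (M : Lall_structure) R t u (e : k.-tuple M) :
  Lall_sat (r2 R t u) e = mrel2 R (Lall_eval t e) (Lall_eval u e).
Proof.
rewrite /= /mrel2 (mktuple_tnth (fun t => Lall_eval t e)).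
by congr interp_rel; apply: val_inj.
Qed.

End Transfer.

Definition v0 k : Lall_term k.+1 := AVar (@Ordinal k.+1 0 isT).
Definition v1 k : Lall_term k.+2 := AVar (@Ordinal k.+2 1 isT).
Definition v2 k : Lall_term k.+3 := AVar (@Ordinal k.+3 2 isT).
Definition v3 k : Lall_term k.+4 := AVar (@Ordinal k.+4 3 isT).
Arguments v0 {k}.
Arguments v1 {k}.
Arguments v2 {k}.
Arguments v3 {k}.

Definition satE := (sat_r2, eval_t1, eval_t2, eval_tc).
Opaque tc t1 t2 r2.
Section Facts.

Lemma nat_mem_le x a : nat_mem x a -> 2 ^ x <= a.
Proof. by rewrite /nat_mem; case: leqP => // lt; rewrite divn_small. Qed.

Lemma nat_mem_lt x a : nat_mem x a -> x < a.
Proof. by move/nat_mem_le; apply: leq_trans; rewrite ltn_expl. Qed.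

Lemma nat_mem_bound N a : (forall x, nat_mem x a -> x < N) -> a < 2 ^ N.
Proof.
move=> a_lt; rewrite ltnNge; apply/negP => le_a.
have a_gt0 : 0 < a by apply: leq_trans le_a; rewrite expn_gt0.
have /andP[lo hi] := trunc_log_bounds (isT : 1 < 2) a_gt0.
have : trunc_log 2 a < N.
  apply: a_lt; rewrite /nat_mem.
  suff -> : a %/ 2 ^ trunc_log 2 a = 1 by [].
  apply/eqP; rewrite eqn_leq -ltnS ltn_divLR ?expn_gt0// -expnS hi.
  by rewrite divn_gt0 ?expn_gt0.
by rewrite ltnNge -ltnS -(@ltn_exp2l 2)// (leq_ltn_trans le_a).
Qed.

Lemma mem_nat_card x a : (x \in [seq x <- iota 0 a | odd (a %/ 2 ^ x)]) = odd (a %/ 2 ^ x).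
Proof.
rewrite mem_filter mem_iota leq0n add0n; apply/andP/idP => [[]//|h].
by split=> //; apply: nat_mem_lt.
Qed.

Lemma nat_card_le a b : (forall x, nat_mem x a -> nat_mem x b) ->
  nat_card a <= nat_card b.
Proof.
move=> ab; apply: uniq_leq_size; first by rewrite filter_uniq ?iota_uniq.
by move=> x; rewrite !mem_nat_card; apply: ab.
Qed.

Lemma nat_card_leU a b c :
  (forall x, nat_mem x c -> nat_mem x a \/ nat_mem x b) ->
  nat_card c <= nat_card a + nat_card b.
Proof.
move=> cab; rewrite /nat_card -size_cat; apply: uniq_leq_size.
  by rewrite filter_uniq ?iota_uniq.
move=> x; rewrite mem_cat !mem_nat_card => /cab; rewrite /nat_mem.
by case=> ->; rewrite ?orbT.
Qed.

Lemma nat_card_gt0 x a : nat_mem x a -> 0 < nat_card a.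
Proof.
move=> xa; rewrite /nat_card; have := mem_nat_card x a.
by rewrite (xa : odd _ = true); case: (filter _ _).
Qed.

Lemma finite_set_coded (A : set nat) N : (forall x, A x -> x < N) ->
  exists2 a, a < 2 ^ N & forall x, nat_mem x a <-> A x.
Proof.
elim: N A => [|N IH] A A_lt.
  exists 0; [exact: expn_gt0|]; move=> x; rewrite /nat_mem div0n; split=> [//|/A_lt//].
have [x|a a_lt aP] := IH (A `&` [set x | x < N]); first by case.
have [AN|AN] := pselect (A N); last first.
  exists a; first by rewrite expnS mul2n -addnn ltn_addr.
  move=> x; rewrite aP; split=> [[]//|Ax]; split=> //=.
  have := A_lt x Ax; rewrite ltnS leq_eqVlt => /orP[/eqP xN|//].
  by case: AN; rewrite -xN.
exists (a + 2 ^ N); first by rewrite expnS mul2n -addnn ltn_add2r.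
move=> x; have [xN|Nx] := ltnP x N.
  have -> : nat_mem x (a + 2 ^ N) = nat_mem x a.
    rewrite /nat_mem -(subnKC xN) addSnnS expnD divnDr ?dvdn_mulr//.
    by rewrite mulKn ?expn_gt0// oddD expnS mul2n odd_double addbF.
  by rewrite aP; split=> [[]//|].
have [<-|xN] := eqVneq N x.
  by rewrite /nat_mem divnDr// divnn expn_gt0 divn_small//.
have ltNx : N < x by rewrite ltn_neqAle xN.
split=> [/nat_mem_le|/A_lt]; last by rewrite ltnS leqNgt ltNx.
rewrite leqNgt; case/negP; apply: (@leq_trans (2 ^ N.+1)).
  by rewrite expnS mul2n -addnn ltn_add2r.
by rewrite leq_exp2l.
Qed.

Lemma set_codeP (A : set nat) N : (forall x, A x -> x < N) ->
  forall x, nat_mem x (set_code A) <-> A x.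
Proof.
move=> /finite_set_coded[a _ aP] x; rewrite /set_code.
by case: xgetP => [c _ /(_ x)|/(_ a) []].
Qed.

Lemma nat_pair_lt i j k : i < k -> j < k -> nat_pair i j < nat_pair k k.
Proof.
move=> ik jk; rewrite /nat_pair -addnS leq_add// leq_bin2l//.
by rewrite ltnS leq_add// ltnW.
Qed.

Lemma sample_space_codeP k w :
  nat_mem w (sample_space_code k) <-> graph_structure k k./2 w.
Proof.
apply: (@set_codeP _ (2 ^ nat_pair k k)) => {}w [f wP].
apply: nat_mem_bound => e /wP[i ->].
rewrite nat_pair_lt//; apply: (leq_trans (ltn_ord _)).
by rewrite -divn2 leq_div.
Qed.

End Facts.

Arguments AEq {k} & _ _.
Arguments ANot {k} & _.
Arguments AAnd {k} & _ _.
Arguments AOr {k} & _ _.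
Arguments AImp {k} & _ _.
Arguments AAll {k} & _.
Arguments AEx {k} & _.
Arguments t1 {k} & f t.
Arguments t2 {k} & f t u.
Arguments r2 {k} & R t u.

Section ModelFacts.
Variable M : Lall_structure.
Hypothesis MTh : models_true_arithmetic M.

Lemma mset_diff (o a : M) :
  exists c, forall x, mmem x c <-> (mmem x o /\ ~ mmem x a).
Proof.
have /MTh/=/(_ o a)[c cP] : @Lall_sat standard_model 0 (AAll (AAll (AEx (AAll (AAnd
    (AImp (r2 nat_mem v0 v1)
          (AAnd (r2 nat_mem v0 v3) (ANot (r2 nat_mem v0 v2))))
    (AImp (AAnd (r2 nat_mem v0 v3) (ANot (r2 nat_mem v0 v2)))
          (r2 nat_mem v0 v1))))))) [tuple].
  rewrite /=; move=> {}o {}a.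
  have [x [/nat_mem_lt//]|c _ cP] := @finite_set_coded
    [set x | nat_mem x o /\ ~ nat_mem x a] o.
  by exists c => x; rewrite !satE; split=> /cP.
by by exists c => x; move: (cP x); rewrite !satE => -[].
Qed.

Lemma mset_union (a b : M) :
  exists c, forall x, mmem x c <-> (mmem x a \/ mmem x b).
Proof.
have /MTh/=/(_ a b)[c cP] : @Lall_sat standard_model 0 (AAll (AAll (AEx (AAll (AAnd
    (AImp (r2 nat_mem v0 v1) (AOr (r2 nat_mem v0 v3) (r2 nat_mem v0 v2)))
    (AImp (AOr (r2 nat_mem v0 v3) (r2 nat_mem v0 v2)) (r2 nat_mem v0 v1)))))))
    [tuple].
  rewrite /=; move=> {}a {}b.
  have [x|c _ cP] := @finite_set_coded
    [set x | nat_mem x a \/ nat_mem x b] (a + b).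
    by case=> /nat_mem_lt; [exact: ltn_addr | exact: ltn_addl].
  by exists c => x; rewrite !satE; split=> /cP.
by by exists c => x; move: (cP x); rewrite !satE => -[].
Qed.

Lemma mlt_card_union (a b c o : M) (k : nat) :
  (forall x, mmem x c -> mmem x a \/ mmem x b) ->
  mlt (mfun2 muln (std M (2 * k)) (mcard a)) o ->
  mlt (mfun2 muln (std M (2 * k)) (mcard b)) o ->
  mlt (mfun2 muln (std M k) (mcard c)) o.
Proof.
move=> cab ao bo.
have /MTh/=/(_ a b c o) : @Lall_sat standard_model 0
    (AAll (AAll (AAll (AAll (AImp
      (AAll (AImp (r2 nat_mem v0 v2) (AOr (r2 nat_mem v0 (AVar (@Ordinal 5 4 isT))) (r2 nat_mem v0 v3))))
      (AImp (r2 (fun x y => x < y) (t2 muln (tc _ (2 * k)) (t1 nat_card v3)) v0)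
      (AImp (r2 (fun x y => x < y) (t2 muln (tc _ (2 * k)) (t1 nat_card v2)) v0)
            (r2 (fun x y => x < y) (t2 muln (tc _ k) (t1 nat_card v1)) v0))))))))
    [tuple].
  rewrite /=; move=> {cab ao bo}a {}b {}c {}o; rewrite !satE => cab ao bo.
  have {}cab : forall x, nat_mem x c -> nat_mem x a \/ nat_mem x b.
    by move=> x; have := cab x; rewrite !satE.
  have : 2 * k * nat_card a < o by [].
  have : 2 * k * nat_card b < o by [].
  rewrite -!mulnA !mul2n => {}bo {}ao.
  suff : k * nat_card c < o by [].
  apply: (leq_ltn_trans (leq_mul (leqnn k) (nat_card_leU cab))).
  by rewrite -ltn_double mulnDr doubleD -[o.*2]addnn -addSn leq_add// ltnW.
rewrite !satE; apply => // x; rewrite !satE; exact: cab.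
Qed.

Lemma mle_lt_trans (x y z : M) : mle x y -> mlt y z -> mlt x z.
Proof.
have /MTh/=/(_ x y z) : @Lall_sat standard_model 0 (AAll (AAll (AAll
    (AImp (r2 (fun x y => x <= y) v2 v1)
    (AImp (r2 (fun x y => x < y) v1 v0) (r2 (fun x y => x < y) v2 v0))))))
    [tuple].
  by rewrite /=; move=> {}x {}y {}z; rewrite !satE; apply: leq_ltn_trans.
by rewrite !satE.
Qed.

Lemma mle_trans (x y z : M) : mle x y -> mle y z -> mle x z.
Proof.
have /MTh/=/(_ x y z) : @Lall_sat standard_model 0 (AAll (AAll (AAll
    (AImp (r2 (fun x y => x <= y) v2 v1)
    (AImp (r2 (fun x y => x <= y) v1 v0) (r2 (fun x y => x <= y) v2 v0))))))
    [tuple].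
  by rewrite /=; move=> {}x {}y {}z; rewrite !satE; apply: leq_trans.
by rewrite !satE.
Qed.

Lemma mfun1_le f (x : M) : (forall i, f i <= i) -> mle (mfun1 f x) x.
Proof.
move=> f_le.
have /MTh/=/(_ x) : @Lall_sat standard_model 0 (AAll
    (r2 (fun x y => x <= y) (t1 f v0) v0)) [tuple].
  by rewrite /=; move=> i; rewrite !satE; apply: f_le.
by rewrite !satE.
Qed.

Lemma mfun2_le f (x y : M) : (forall i j, f i j <= i) -> mle (mfun2 f x y) x.
Proof.
move=> f_le.
have /MTh/=/(_ x y) : @Lall_sat standard_model 0 (AAll (AAll
    (r2 (fun x y => x <= y) (t2 f v1 v0) v1))) [tuple].
  by rewrite /=; move=> i j; rewrite !satE; apply: f_le.
by rewrite !satE.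
Qed.

Lemma std_le1_exp (c : nat) (x : M) : c <= 1 -> mle (std M c) (mfun1 (expn 2) x).
Proof.
move=> c_le1.
have /MTh/=/(_ x) : @Lall_sat standard_model 0 (AAll
    (r2 (fun x y => x <= y) (tc _ c) (t1 (expn 2) v0))) [tuple].
  by rewrite /=; move=> i; rewrite !satE; apply: (leq_trans c_le1); apply: expn_gt0.
by rewrite !satE.
Qed.

Lemma nonstandard_ge2 (n : M) : nonstandard n -> mle (std M 2) n.
Proof.
move=> n_ns.
have /MTh/=/(_ n) : @Lall_sat standard_model 0 (AAll
    (AOr (r2 (fun x y => x <= y) (tc _ 2) v0)
         (AOr (AEq v0 (tc _ 0)) (AEq v0 (tc _ 1))))) [tuple].
  by rewrite /=; case=> [|[|i]] /=; [right; left | right; right | left; rewrite !satE].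
by rewrite !satE => -[//|[|]] /n_ns.
Qed.

End ModelFacts.

Lemma sample_space_gt0 k : 1 < k -> 0 < nat_card (sample_space_code k).
Proof.
case: k => [|[|k]]// _.
pose f : {ffun 'I_k.+2 -> 'I_k./2.+1} := [ffun=> ord0].
have [e [i ->]|w _ wP] := @finite_set_coded
    [set e | exists i : 'I_k.+2, e = nat_pair i (f i)] (nat_pair k.+2 k.+2).
  by rewrite nat_pair_lt// ffunE.
by apply: (@nat_card_gt0 w); apply/sample_space_codeP; exists f.
Qed.

Section ModelFacts2.
Variable M : Lall_structure.
Hypothesis MTh : models_true_arithmetic M.

Lemma mset_empty : exists a : M, forall x, ~ mmem x a.
Proof.
have /MTh/=[a aP] : @Lall_sat standard_model 0
    (AEx (AAll (ANot (r2 nat_mem v0 v1)))) [tuple].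
  rewrite /=; exists 0 => x; rewrite satE.
  by rewrite -[mrel2 _ _ _]/(nat_mem x 0) /nat_mem div0n.
by exists a => x; move: (aP x); rewrite satE.
Qed.

Lemma mcard_empty (a n : M) (k : nat) : nonstandard n -> (forall x, ~ mmem x a) ->
  mlt (mfun2 muln (std M k) (mcard a)) (mcard (mfun1 sample_space_code n)).
Proof.
move=> /(nonstandard_ge2 MTh) n_ge2 a0.
have /MTh/=/(_ a n) : @Lall_sat standard_model 0
    (AAll (AAll (AImp (AAll (ANot (r2 nat_mem v0 v2)))
       (AImp (r2 (fun x y => x <= y) (tc _ 2) v0)
         (r2 (fun x y => x < y) (t2 muln (tc _ k) (t1 nat_card v1))
            (t1 nat_card (t1 sample_space_code v0))))))) [tuple].
  rewrite /= => b l; rewrite !satE => b0 l_ge2.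
  have {}b0 x : ~ nat_mem x b by have := b0 x; rewrite satE.
  have : nat_card b <= nat_card 0 by apply: nat_card_le => x /b0.
  rewrite {2}/nat_card/= leqn0 => /eqP card_b.
  suff : k * nat_card b < nat_card (sample_space_code l) by [].
  by rewrite card_b muln0; apply: sample_space_gt0.
rewrite !satE; apply=> // x; rewrite satE; exact: a0.
Qed.

End ModelFacts2.

Transparent tc t1 t2 r2.

Section Structure.
Variables (M : Lall_structure) (n : M).

(* [2 ^ (n ^ (1 / t))] and, in [Tnb], [n ^ (1 / t)] are rounded by means of
   [nat_root]; as [t] ranges over all nonstandard numbers, the direction of
   rounding is immaterial. *)
Definition Mn : set M :=
  [set x | exists2 t, nonstandard t & mle x (mfun1 (expn 2) (mfun2 nat_root n t))].

Definition in_Ln j (f : j.-tuple nat -> nat) : Prop :=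
  forall x : j.-tuple M, (forall i, Mn (tnth x i)) -> Mn (interp_fun f x).

Definition sample_space : M := mfun1 sample_space_code n.
Definition sample : Type := {w : M | mmem w sample_space}.

Definition Tnb : set M := [set T |
  [/\ mrel2 neighbor_tree_code n T,
      forall x, mrel2 tree_leaf_code T x -> Mn x
    & exists2 t, nonstandard t & mle (mfun1 tree_depth_code T) (mfun2 nat_root n t)]].

Definition random_var : Type := sample -> M.

Definition Fnb : set random_var := [set alpha |
  exists2 T, Tnb T & forall w, alpha w = mfun2 tree_run_code T (sval w)].

(* [Theta w] is the code of a partial function. *)
Definition random_fun : Type := sample -> M.

Definition is_random_fun k (Theta : random_fun) : Prop :=
  forall w, mrel1 (fun_code k) (Theta w) /\
    forall v : k.+1.-tuple M, interp_rel (@graph_sym k.+1) [tuple of Theta w :: v] ->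
      forall i, Mn (tnth v i).

Definition rapp k (Theta : random_fun) (alphas : k.-tuple random_var) : random_var :=
  fun w => mapp (Theta w) [tuple of map (fun alpha => alpha w) alphas].

Definition component (g i : M) : random_var :=
  fun w => mapp (mfun2 seq_nth g i) [tuple sval w].

Definition unary_condition (Theta : random_fun) : Prop :=
  exists g m : M, [/\ Mn m, mfun1 seq_size g = m,
    forall i, mlt i m -> Fnb (component g i)
  & forall alpha, Fnb alpha -> forall w,
      (mlt (alpha w) m -> rapp Theta [tuple alpha] w = component g (alpha w) w) /\
      (~ mlt (alpha w) m -> rapp Theta [tuple alpha] w = std M 0)].

(* [Gnb k] is the family of the [k]-ary members; the conditions on the arities
   [k > 1] are resolved by recursion on [k], and only [k > 0] is meant. *)
Fixpoint Gnb (k : nat) (Theta : random_fun) : Prop :=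
  match k with
  | 0 => False
  | 1 => is_random_fun 1 Theta /\ unary_condition Theta
  | (j.+1 as k').+1 => is_random_fun j.+2 Theta /\
      exists2 Theta', Gnb k' Theta' &
        forall (alphas : j.-tuple random_var) (beta gamma : random_var),
          (forall i, Fnb (tnth alphas i)) -> Fnb beta -> Fnb gamma ->
          rapp Theta [tuple of rcons (rcons alphas beta) gamma] =
          rapp Theta' [tuple of
            rcons alphas (fun w => mfun2 nat_pair (beta w) (gamma w))]
  end.

(* [a] codes exactly the set of the underlying elements of [A], so that
   [mcard a] is the cardinality of [A]. *)
Definition event_code (a : M) (A : set sample) : Prop :=
  forall x, mmem x a <-> exists2 w, A w & sval w = x.

Definition coded (A : set sample) : Prop := exists a, event_code a A.

Definition event : Type := {A : set sample | `[< coded A >]}.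

Definition infinitesimal (A : set sample) : Prop :=
  exists2 a, event_code a A & infinitesimal_ratio (mcard a) (mcard sample_space).

Lemma mmem_sval a A w : event_code a A -> mmem (sval w) a <-> A w.
Proof.
move=> aA; rewrite aA; split=> [[[y q] Aw /= yx]|]; last by exists w.
case: w yx => x p /= yx; subst y.
by rewrite (Prop_irrelevance p q).
Qed.

End Structure.

Section BooleanAlgebra.
Variables (M : Lall_structure) (MTh : models_true_arithmetic M).
Variables (n : M) (n_ns : nonstandard n).
Implicit Types (A B C : set (sample n)).

Lemma event_codeP a A : event_code a A <->
  (forall x, mmem x a -> mmem x (sample_space n)) /\
  (forall w, mmem (sval w) a <-> A w).
Proof.
split=> [aA|[a_sub aA] x].
  split=> [x /aA[w _ <-]|w]; first exact: (svalP w).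
  exact: mmem_sval.
split=> [xa|[w Aw <-]]; last exact/aA.
by exists (exist _ x (a_sub _ xa)) => //; apply/aA.
Qed.

Lemma codedC A : coded A -> coded (~` A).
Proof.
case=> a /(event_codeP _ _).1[_ aA]; have [c cP] := mset_diff MTh (sample_space n) a.
exists c; apply: (event_codeP _ _).2; split=> [x /cP[]//|w].
rewrite cP /setC /mkset -aA; split=> [[]//|nw].
by split=> //; apply: (svalP w).
Qed.

Lemma codedU A B : coded A -> coded B -> coded (A `|` B).
Proof.
move=> [a /(event_codeP _ _).1[a_sub aA]] [b /(event_codeP _ _).1[b_sub bB]].
have [c cP] := mset_union MTh a b.
exists c; apply: (event_codeP _ _).2; split=> [x /cP[/a_sub|/b_sub]//|w].
by rewrite cP aA bB.
Qed.

Lemma codedI A B : coded A -> coded B -> coded (A `&` B).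
Proof.
move=> cA cB; rewrite -[_ `&` _]setCK setCI.
exact/codedC/codedU/codedC/cB/codedC.
Qed.

Lemma coded0 : coded (set0 : set (sample n)).
Proof.
have [a aP] := mset_empty MTh; exists a; apply: (event_codeP _ _).2.
by split=> [x /aP//|w]; split=> [/aP|].
Qed.

Lemma codedT : coded (setT : set (sample n)).
Proof. by rewrite -setC0; apply/codedC/coded0. Qed.

Lemma infinitesimal0 : infinitesimal (set0 : set (sample n)).
Proof.
have [a aP] := mset_empty MTh; exists a; last by move=> k _; apply: mcard_empty.
by apply: (event_codeP _ _).2; split=> [x /aP//|w]; split=> [/aP|].
Qed.

Lemma infinitesimal_subU A B C : coded C -> infinitesimal A -> infinitesimal B ->
  C `<=` A `|` B -> infinitesimal C.
Proof.
move=> [c cC] [a aA a0] [b bB b0] CAB; exists c => // k k_gt0.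
apply: (@mlt_card_union _ MTh a b); [|by apply: a0; rewrite muln_gt0..|].
  by move=> x /cC[w /CAB[Aw|Bw] <-]; [left|right]; apply/mmem_sval;
    [exact: aA| |exact: bB|].
by apply: b0; rewrite muln_gt0.
Qed.

Lemma infinitesimalS A B : coded A -> infinitesimal B -> A `<=` B ->
  infinitesimal A.
Proof. by move=> cA B0 AB; apply: (infinitesimal_subU cA B0 B0); rewrite setUid. Qed.

Lemma infinitesimalU A B : infinitesimal A -> infinitesimal B ->
  infinitesimal (A `|` B).
Proof.
move=> A0 B0; apply: (infinitesimal_subU _ A0 B0) => //.
by case: A0 B0 => [a aA _] [b bB _]; apply: codedU; [exists a|exists b].
Qed.

Local Notation event := (event n).
Implicit Types E F G : event.

Lemma event_coded E : coded (sval E).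
Proof. by have /asboolP := svalP E. Qed.

Definition mkevent A (cA : coded A) : event := exist _ A (asboolT cA).
Definition eventC E : event := mkevent (codedC (event_coded E)).
Definition eventU E F : event := mkevent (codedU (event_coded E) (event_coded F)).
Definition eventI E F : event := mkevent (codedI (event_coded E) (event_coded F)).

Definition event_eqv E F : bool := `[< infinitesimal (sval E `+` sval F) >].

Lemma event_eqvE E F : sval E = sval F -> event_eqv E F.
Proof. by move=> EF; apply/asboolP; rewrite EF setYK; apply: infinitesimal0. Qed.

Lemma codedY A B : coded A -> coded B -> coded (A `+` B).
Proof.
move=> cA cB; rewrite /setY !setDE.
by apply: codedU; apply: codedI => //; apply: codedC.
Qed.

Lemma event_eqv_refl : reflexive event_eqv.
Proof. by move=> E; apply: event_eqvE. Qed.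

Lemma event_eqv_sym : symmetric event_eqv.
Proof. by move=> E F; rewrite /event_eqv setYC. Qed.

Lemma event_eqv_trans : transitive event_eqv.
Proof.
move=> F E G /asboolP EF /asboolP FG; apply/asboolP.
apply: (infinitesimal_subU _ EF FG); first by apply: codedY; apply: event_coded.
by move=> w; rewrite /setY /=; have [|] := pselect (sval F w); tauto.
Qed.

Canonical event_equiv :=
  EquivRel event_eqv event_eqv_refl event_eqv_sym event_eqv_trans.

(* The quotient of the algebra of coded events by the ideal of infinitesimal
   events. *)
Definition Balg : Type := {eq_quot event_equiv}.
HB.instance Definition _ := Choice.on Balg.

Definition event_class (E : event) : Balg := \pi_{eq_quot event_equiv} E.

Lemma event_classE E F : event_class E = event_class F <->
  infinitesimal (sval E `+` sval F).
Proof. by split=> [/eqmodP/asboolP//|EF]; apply/eqmodP/asboolP. Qed.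

Lemma event_class_set E F : sval E = sval F -> event_class E = event_class F.
Proof. by move=> EF; apply/eqmodP/event_eqvE. Qed.

Lemma event_class_repr (x : Balg) : event_class (repr x) = x.
Proof. exact: reprK. Qed.

Lemma event_classP (P : Balg -> Prop) :
  (forall E, P (event_class E)) -> forall x, P x.
Proof. by move=> PE x; rewrite -(event_class_repr x). Qed.

Lemma infinitesimal_repr E : infinitesimal (sval (repr (event_class E)) `+` sval E).
Proof. by apply/event_classE; rewrite event_class_repr. Qed.

Definition Bmeet (x y : Balg) : Balg := event_class (eventI (repr x) (repr y)).
Definition Bjoin (x y : Balg) : Balg := event_class (eventU (repr x) (repr y)).
Definition Bcompl (x : Balg) : Balg := event_class (eventC (repr x)).

Lemma BmeetE E F : Bmeet (event_class E) (event_class F) = event_class (eventI E F).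
Proof.
apply/event_classE.
apply: infinitesimal_subU (infinitesimal_repr E) (infinitesimal_repr F) _.
  by apply: codedY; apply: event_coded.
move=> w /=; rewrite /setD /setI /setU /mkset.
have [] := pselect (sval (repr (event_class E)) w);
  have [] := pselect (sval (repr (event_class F)) w);
  have [] := pselect (sval E w); have [] := pselect (sval F w); tauto.
Qed.

Lemma BjoinE E F : Bjoin (event_class E) (event_class F) = event_class (eventU E F).
Proof.
apply/event_classE.
apply: infinitesimal_subU (infinitesimal_repr E) (infinitesimal_repr F) _.
  by apply: codedY; apply: event_coded.
move=> w /=; rewrite /setD /setI /setU /mkset.
have [] := pselect (sval (repr (event_class E)) w);
  have [] := pselect (sval (repr (event_class F)) w);
  have [] := pselect (sval E w); have [] := pselect (sval F w); tauto.
Qed.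

Lemma BcomplE E : Bcompl (event_class E) = event_class (eventC E).
Proof.
apply/event_classE; apply: infinitesimalS (infinitesimal_repr E) _.
  by apply: codedY; apply: event_coded.
move=> w /=; rewrite /setD /setI /setU /setC /mkset.
have [] := pselect (sval (repr (event_class E)) w);
  have [] := pselect (sval E w); tauto.
Qed.

Ltac Bset := rewrite ?(BmeetE, BjoinE, BcomplE); apply: event_class_set => /=;
  apply/seteqP; split=> w; rewrite /= /setI /setU /setC /mkset; tauto.

Fact BmeetC : commutative Bmeet.
Proof. by elim/event_classP=> E; elim/event_classP=> F; Bset. Qed.
Fact BjoinC : commutative Bjoin.
Proof. by elim/event_classP=> E; elim/event_classP=> F; Bset. Qed.
Fact BmeetA : associative Bmeet.
Proof.
by elim/event_classP=> E; elim/event_classP=> F; elim/event_classP=> G; Bset.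
Qed.
Fact BjoinA : associative Bjoin.
Proof.
by elim/event_classP=> E; elim/event_classP=> F; elim/event_classP=> G; Bset.
Qed.
Fact BjoinKI y x : Bmeet x (Bjoin x y) = x.
Proof. by elim/event_classP: x => E; elim/event_classP: y => F; Bset. Qed.
Fact BmeetKU y x : Bjoin x (Bmeet x y) = x.
Proof. by elim/event_classP: x => E; elim/event_classP: y => F; Bset. Qed.
Fact BmeetUl : left_distributive Bmeet Bjoin.
Proof.
by elim/event_classP=> E; elim/event_classP=> F; elim/event_classP=> G; Bset.
Qed.
Fact Bmeetxx : idempotent_op Bmeet.
Proof. by elim/event_classP=> E; Bset. Qed.

Fact Balg_display : Order.disp_t. Proof. exact: Order.Disp tt tt. Qed.

HB.instance Definition _ := @Order.isMeetJoinDistrLattice.Build Balg_display Balg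
  (fun x y => Bmeet x y == x) (fun x y => (y != x) && (Bmeet x y == x))
  Bmeet Bjoin (fun _ _ => erefl) (fun _ _ => erefl)
  BmeetC BjoinC BmeetA BjoinA BjoinKI BmeetKU BmeetUl Bmeetxx.

Definition Bbot : Balg := event_class (mkevent coded0).
Definition Btop : Balg := event_class (mkevent codedT).

Fact Ble0x (x : Balg) : (Bbot <= x)%O.
Proof.
apply/eqP; elim/event_classP: x => E; rewrite /Bbot.
by rewrite [LHS]BmeetE; apply: event_class_set => /=; rewrite set0I.
Qed.
HB.instance Definition _ := Order.hasBottom.Build Balg_display Balg Ble0x.

Fact Blex1 (x : Balg) : (x <= Btop)%O.
Proof.
apply/eqP; elim/event_classP: x => E; rewrite /Btop.
by rewrite [LHS]BmeetE; apply: event_class_set => /=; rewrite setIT.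
Qed.
HB.instance Definition _ := Order.hasTop.Build Balg_display Balg Blex1.

Fact BjoinxC (x : Balg) : Bjoin x (Bcompl x) = Btop.
Proof.
elim/event_classP: x => E; rewrite BcomplE BjoinE.
by apply: event_class_set => /=; rewrite setUv.
Qed.
Fact BmeetxC (x : Balg) : Bmeet x (Bcompl x) = Bbot.
Proof.
elim/event_classP: x => E; rewrite BcomplE BmeetE.
by apply: event_class_set => /=; rewrite setICr.
Qed.
HB.instance Definition _ :=
  @Order.TBDistrLattice_hasComplement.Build Balg_display Balg Bcompl BjoinxC BmeetxC.

End BooleanAlgebra.

Section TwoSortedLanguage.
Variables (M : Lall_structure) (n : M).

(* [L2_term k s] and [L2_formula k s]: the free number variables are among [k],
   and the free set-sort variables are [size s] many, the [i]-th one of arity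
   [nth 0 s i].  A quantifier binds the variable [ord0]; set-sort quantifiers
   range over a positive arity [j.+1]. *)
Inductive L2_term (k : nat) (s : seq nat) : Type :=
| L2Var of 'I_k
| L2Fun j (f : j.-tuple nat -> nat) of in_Ln n f & ('I_j -> L2_term k s)
| L2App (X : 'I_(size s)) of ('I_(nth 0 s X) -> L2_term k s).

Inductive L2_formula : nat -> seq nat -> Type :=
| L2Eq k s of L2_term k s & L2_term k s : L2_formula k s
| L2Rel k s j (R : set (j.-tuple nat)) of ('I_j -> L2_term k s) : L2_formula k s
| L2FunEq k s (X Y : 'I_(size s)) of nth 0 s X = nth 0 s Y : L2_formula k s
| L2Not k s of L2_formula k s : L2_formula k s
| L2And k s of L2_formula k s & L2_formula k s : L2_formula k s
| L2Or k s of L2_formula k s & L2_formula k s : L2_formula k s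
| L2All k s of L2_formula k.+1 s : L2_formula k s
| L2Ex k s of L2_formula k.+1 s : L2_formula k s
| L2AllFun k s j of L2_formula k (j.+1 :: s) : L2_formula k s
| L2ExFun k s j of L2_formula k (j.+1 :: s) : L2_formula k s.

Fixpoint L2_eval k s (t : L2_term k s) (e : k.-tuple (random_var n))
    (E : (size s).-tuple (random_fun n)) : random_var n :=
  match t with
  | L2Var i => tnth e i
  | L2Fun j f _ ts => fun w => interp_fun f [tuple L2_eval (ts i) e E w | i < j]
  | L2App X ts => rapp (tnth E X) [tuple L2_eval (ts i) e E | i < nth 0 s X]
  end.

Variables (MTh : models_true_arithmetic M) (n_ns : nonstandard n).
Local Notation B := (Balg MTh n_ns).

Definition is_class_of (A : set (sample n)) (b : B) : Prop :=
  exists2 E : event n, sval E = A & b = event_class MTh n_ns E.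

(* [truth_value phi e E b]: the truth value of [phi], under the assignments [e]
   and [E], is [b].  It is a relation because an event is in the algebra only if
   it is coded in [M]; there is at most one truth value (truth_value_uniq). *)
Fixpoint truth_value k s (phi : L2_formula k s) :
    k.-tuple (random_var n) -> (size s).-tuple (random_fun n) -> B -> Prop :=
  match phi with
  | L2Eq k s t u => fun e E =>
      is_class_of [set w | L2_eval t e E w = L2_eval u e E w]
  | L2Rel k s j R ts => fun e E =>
      is_class_of [set w | interp_rel R [tuple L2_eval (ts i) e E w | i < j]]
  | L2FunEq k s X Y _ => fun e E => is_class_of [set w | tnth E X w = tnth E Y w]
  | L2Not k s f => fun e E b => exists2 b1, truth_value f e E b1 & b = (~` b1)%O
  | L2And k s f g => fun e E b => exists b1 b2,
      [/\ truth_value f e E b1, truth_value g e E b2 & b = (b1 `&` b2)%O]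
  | L2Or k s f g => fun e E b => exists b1 b2,
      [/\ truth_value f e E b1, truth_value g e E b2 & b = (b1 `|` b2)%O]
  | L2All k s f => fun e E b => exists2 c : random_var n -> B,
      forall alpha, Fnb alpha -> truth_value f [tuple of alpha :: e] E (c alpha) &
      infimums [set c alpha | alpha in @Fnb M n] b
  | L2Ex k s f => fun e E b => exists2 c : random_var n -> B,
      forall alpha, Fnb alpha -> truth_value f [tuple of alpha :: e] E (c alpha) &
      supremums [set c alpha | alpha in @Fnb M n] b
  | L2AllFun k s j f => fun e E b => exists2 c : random_fun n -> B,
      forall Theta, Gnb j.+1 Theta -> truth_value f e [tuple of Theta :: E] (c Theta) &
      infimums [set c Theta | Theta in @Gnb M n j.+1] b
  | L2ExFun k s j f => fun e E b => exists2 c : random_fun n -> B,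
      forall Theta, Gnb j.+1 Theta -> truth_value f e [tuple of Theta :: E] (c Theta) &
      supremums [set c Theta | Theta in @Gnb M n j.+1] b
  end.

Lemma is_class_of_uniq A b b' : is_class_of A b -> is_class_of A b' -> b = b'.
Proof. by case=> E EA -> [F FA ->]; apply: event_class_set; rewrite EA. Qed.

Lemma truth_value_uniq k s (phi : L2_formula k s) e E b b' :
  truth_value phi e E b -> truth_value phi e E b' -> b = b'.
Proof.
have image_eq (T : Type) (D : set T) (c c' : T -> B) :
    (forall x, D x -> c x = c' x) -> [set c x | x in D] = [set c' x | x in D].
  by move=> cc'; apply: eq_imagel.
elim: phi e E b b' => {k s} /=.
- by move=> k s t u e E b b'; apply: is_class_of_uniq.
- by move=> k s j R ts e E b b'; apply: is_class_of_uniq.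
- by move=> k s X Y XY e E b b'; apply: is_class_of_uniq.
- by move=> k s f IH e E b b' [c /IH Hc ->] [c' /Hc -> ->].
- by move=> k s f IHf g IHg e E b b' [c [d [/IHf Hc /IHg Hd ->]]]
    [c' [d' [/Hc -> /Hd -> ->]]].
- by move=> k s f IHf g IHg e E b b' [c [d [/IHf Hc /IHg Hd ->]]]
    [c' [d' [/Hc -> /Hd -> ->]]].
- move=> k s f IH e E b b' [c Hc Hb] [c' Hc' Hb'].
  rewrite (image_eq _ _ c c') in Hb; last by move=> a Ha; apply: IH (Hc a Ha) (Hc' a Ha).
  exact: is_subset1_infimums Hb Hb'.
- move=> k s f IH e E b b' [c Hc Hb] [c' Hc' Hb'].
  rewrite (image_eq _ _ c c') in Hb; last by move=> a Ha; apply: IH (Hc a Ha) (Hc' a Ha).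
  exact: is_subset1_supremums Hb Hb'.
- move=> k s j f IH e E b b' [c Hc Hb] [c' Hc' Hb'].
  rewrite (image_eq _ _ c c') in Hb; last by move=> a Ha; apply: IH (Hc a Ha) (Hc' a Ha).
  exact: is_subset1_infimums Hb Hb'.
- move=> k s j f IH e E b b' [c Hc Hb] [c' Hc' Hb'].
  rewrite (image_eq _ _ c c') in Hb; last by move=> a Ha; apply: IH (Hc a Ha) (Hc' a Ha).
  exact: is_subset1_supremums Hb Hb'.
Qed.

Lemma Mn_le x y : mle x y -> Mn n y -> Mn n x.
Proof. by move=> xy [t t_ns yt]; exists t => //; apply: (mle_trans MTh xy yt). Qed.

Lemma Ln_const c : c <= 1 -> in_Ln n (fun _ : 0.-tuple nat => c).
Proof.
move=> c_le1 x _; rewrite (tuple0 x); exists n => //.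
exact: std_le1_exp.
Qed.

Lemma Ln_sym1 f : (forall i, f i <= i) -> in_Ln n (sym1 f).
Proof.
move=> f_le x xM; have /Mn_le := mfun1_le MTh (tnth x ord0) f_le.
move=> /(_ (xM _)); rewrite /mfun1; congr (Mn _ (interp_fun _ _)).
by apply: eq_from_tnth => i; rewrite ord1.
Qed.

Lemma Ln_sym2 f : (forall i j, f i j <= i) -> in_Ln n (sym2 f).
Proof.
move=> f_le x xM.
have /Mn_le := mfun2_le MTh (tnth x ord0) (tnth x ord_max) f_le.
move=> /(_ (xM _)); rewrite /mfun2; congr (Mn _ (interp_fun _ _)).
by apply: eq_from_tnth => -[[|[|i]] // lt_i]; rewrite !(tnth_nth (std M 0)).
Qed.

Lemma bit_length_le m : bit_length m <= m.
Proof. by apply: up_log_min => //; rewrite ltn_expl. Qed.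

Section Abbreviations.
Variables (k : nat) (s : seq nat).
Implicit Types t u : L2_term k s.

Definition L2zero : L2_term k s := L2Fun (Ln_const (leq0n 1)) (tnth [tuple]).
Definition L2one : L2_term k s := L2Fun (Ln_const (leqnn 1)) (tnth [tuple]).
Definition L2len t : L2_term k s := L2Fun (Ln_sym1 bit_length_le) (tnth [tuple t]).
Definition L2sub t u : L2_term k s := L2Fun (Ln_sym2 (fun i j => leq_subr j i)) (tnth [tuple t; u]).
Definition L2lt t u : L2_formula k s :=
  L2Rel (rsym2 (fun x y => x < y)) (tnth [tuple t; u]).
Definition L2ge t u : L2_formula k s :=
  L2Rel (rsym2 (fun x y => x >= y)) (tnth [tuple t; u]).
End Abbreviations.

(* The bound variables of [weak_pigeon] are, from the outside in, X, m, x1, x2;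
   hence m, x1 and x2 have the indices 2, 1 and 0. *)
Definition phi_weak_pigeon : L2_formula 3 [:: 1] :=
  let X t : L2_term 3 [:: 1] := @L2App 3 [:: 1] ord0 (tnth [tuple t]) in
  let x2 := L2Var [:: 1] (@Ordinal 3 0 isT) in
  let x1 := L2Var [:: 1] (@Ordinal 3 1 isT) in
  let m := L2Var [:: 1] (@Ordinal 3 2 isT) in
  let len_m_pred := L2sub (L2len m) (L2one _ _) in
  L2Or (L2Eq m (L2zero _ _))
    (L2And (L2And (L2lt (L2len x1) (L2len m)) (L2lt (L2len x2) (L2len m)))
      (L2Or (L2Or (L2ge (L2len (X x1)) len_m_pred) (L2ge (L2len (X x2)) len_m_pred))
        (L2And (L2Not (L2Eq x1 x2)) (L2Eq (X x1) (X x2))))).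

Definition weak_pigeon : L2_formula 0 [::] :=
  L2AllFun (L2All (L2Ex (L2Ex phi_weak_pigeon))).

End TwoSortedLanguage.

(* Main.v *)
Require Import Defs.
Set Warnings "-notation-overridden".
From mathcomp Require Import all_boot all_order.
From mathcomp Require Import boolp classical_sets zify.

Set Implicit Arguments.
Unset Strict Implicit.
Unset Printing Implicit Defensive.

Import Order.Theory.
Local Open Scope classical_set_scope.

(** The universally quantified formula already fails for one instance: [X] is the
    random function [neighbor_rf], whose value at [w] is the function with graph [w],
    and [m] is the constant [n].  As [n] is a power of two, [|x| < |m|] says that
    [x < n], and all neighbors have fewer than [|m| - 1] digits; so for this instance
    the matrix says that [x1] and [x2] are distinct points below [n] with the same
    neighbor.  Elements of the number sort are computed by trees of depth
    [n ^ (1 / t)] with [t] nonstandard, so [x1] and [x2] together see [n ^ o(1)]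
    values of a random function into a set of size [n / 2], and by the birthday bound
    they output a collision with infinitesimal probability only.  For these
    [X] and [m] the matrix thus always has the value bottom, and so do the suprema over [x1] and [x2]
    and the infima over [m] and [X].

    The birthday bound is [card_clash]: by induction on the depth of the tree, over
    sets of functions about which nothing but the answers given so far is known.  It
    is applied to the tree that runs the trees of [x1] and [x2] and then queries both
    outputs, and gives [collision_rare] for natural numbers and
    [collision_infinitesimal] in the model.

    For the infima to be meaningful, the truth values of all other instances must
    exist as well.  Quantifier-free instances denote coded events because every
    random variable involved is internal: it is given by one function symbol with a
    parameter ([internal_Fnb], [internal_rapp]).  Suprema and infima exist because the
    algebra of events is complete ([supremums_exist]); this is where saturation
    enters. *)

(** * Transfer along types of single elements *)

Definition r1 k (A : nat -> Prop) (t : Lall_term k) : Lall_formula k :=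
  @ARel k 1 (rsym1 A) (tnth [tuple t]).

Lemma sat_r1 (N : Lall_structure) k (A : nat -> Prop) (t : Lall_term k) (e : k.-tuple N) :
  Lall_sat (r1 A t) e = mrel1 A (Lall_eval t e).
Proof.
rewrite /= /mrel1 (mktuple_tnth (fun t => Lall_eval t e)).
by congr interp_rel; apply: val_inj.
Qed.

(* Simplification of [Lall_sat] must leave the abbreviated atoms folded, so that
   the evaluation lemmas apply to them. *)
Opaque r1 tc t1 t2 r2.

Section Transfer.
Variable M : Lall_structure.
Hypothesis MTh : models_true_arithmetic M.
Implicit Types (p x y : M) (A B C : nat -> Prop).

(** The sets [A] with [mrel1 A p] form an ultrafilter on the natural numbers,
    the type of [p].  Any finitely many elements of [M] are values of function
    symbols at one [p], and symbols commute with evaluation at [p]; so every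
    quantifier-free statement about them reads [mrel1 A p], where [A] is the same
    statement about natural numbers.  Quantifiers are absorbed by Skolem functions,
    which are function symbols too.  Hence this first lemma, with the closure of the
    ultrafilter under implication, carries all transfer below. *)
Lemma transfer A p : (forall i, A i) -> mrel1 A p.
Proof.
move=> AP; have /MTh/=/(_ p) : @Lall_sat standard_model 0 (AAll (r1 A v0)) [tuple].
  by rewrite /= => i; rewrite sat_r1; apply: AP.
by rewrite sat_r1.
Qed.

Lemma mrel1_imp A B p : (forall i, A i -> B i) -> mrel1 A p -> mrel1 B p.
Proof.
move=> AB; have /MTh/=/(_ p) : @Lall_sat standard_model 0
    (AAll (AImp (r1 A v0) (r1 B v0))) [tuple].
  by rewrite /= => i; rewrite !sat_r1; apply: AB.
by rewrite !sat_r1.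
Qed.

Lemma mrel1_and A B p : mrel1 (fun i => A i /\ B i) p = (mrel1 A p /\ mrel1 B p).
Proof.
apply/propext; split; first by move=> AB; split; move: AB; apply: mrel1_imp => i [].
have /MTh/=/(_ p) : @Lall_sat standard_model 0
    (AAll (AImp (AAnd (r1 A v0) (r1 B v0)) (r1 (fun i => A i /\ B i) v0))) [tuple].
  by rewrite /= => i; rewrite !sat_r1.
by rewrite !sat_r1.
Qed.

Lemma mrel1_not A p : mrel1 (fun i => ~ A i) p = (~ mrel1 A p).
Proof.
have /MTh/=/(_ p) : @Lall_sat standard_model 0 (AAll (AAnd
    (AImp (r1 (fun i => ~ A i) v0) (ANot (r1 A v0)))
    (AImp (ANot (r1 A v0)) (r1 (fun i => ~ A i) v0)))) [tuple].
  by rewrite /= => i; rewrite !sat_r1.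
by rewrite !sat_r1 => -[? ?]; apply/propext.
Qed.

Lemma mrel1_cst (P : Prop) p : mrel1 (fun=> P) p -> P.
Proof.
move=> HP; apply: contrapT => nP; have := transfer p (fun=> nP).
by rewrite mrel1_not.
Qed.

Lemma mrel1_or A B p : mrel1 (fun i => A i \/ B i) p = (mrel1 A p \/ mrel1 B p).
Proof.
apply/propext; split=> [AB|[]]; last 2 first.
- by apply: mrel1_imp => i; left.
- by apply: mrel1_imp => i; right.
apply: contrapT => /not_orP[]; rewrite -!mrel1_not => nA nB.
apply: (@mrel1_cst False p).
have : mrel1 (fun i => (A i \/ B i) /\ (~ A i /\ ~ B i)) p by rewrite !mrel1_and.
by apply: mrel1_imp => i; tauto.
Qed.

Lemma mrel1_imp2 A B C p : (forall i, A i -> B i -> C i) ->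
  mrel1 A p -> mrel1 B p -> mrel1 C p.
Proof.
move=> ABC a b; have : mrel1 (fun i => A i /\ B i) p by rewrite mrel1_and.
by apply: mrel1_imp => i []; apply: ABC.
Qed.

Lemma mrel1_imp3 A B C D p : (forall i, A i -> B i -> C i -> D i) ->
  mrel1 A p -> mrel1 B p -> mrel1 C p -> mrel1 D p.
Proof.
move=> ABC a b c; have : mrel1 (fun i => (A i /\ B i) /\ C i) p by rewrite !mrel1_and.
by apply: mrel1_imp => i [[]]; apply: ABC.
Qed.

Lemma mrel1_iff A B p : (forall i, A i <-> B i) -> mrel1 A p <-> mrel1 B p.
Proof. by move=> AB; split; apply: mrel1_imp => i /AB. Qed.

Lemma interp_fun_param k (f : k.-tuple nat -> nat) (gs : k.-tuple (nat -> nat)) p :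
  interp_fun f [tuple mfun1 (tnth gs i) p | i < k] =
  mfun1 (fun j => f [tuple tnth gs i j | i < k]) p.
Proof.
have /MTh/=/(_ p) : @Lall_sat standard_model 0 (AAll
    (AEq (AFun f (fun i => t1 (tnth gs i) v0))
         (t1 (fun j => f [tuple tnth gs i j | i < k]) v0))) [tuple] by [].
rewrite eval_t1 /= => <-; congr interp_fun.
by apply: eq_from_tnth => i; rewrite !tnth_mktuple eval_t1.
Qed.

Lemma interp_rel_param k (R : set (k.-tuple nat)) (gs : k.-tuple (nat -> nat)) p :
  interp_rel R [tuple mfun1 (tnth gs i) p | i < k] =
  mrel1 (fun j => R [tuple tnth gs i j | i < k]) p.
Proof.
pose S := r1 (fun j => R [tuple tnth gs i j | i < k]) (@v0 0).
pose T := @ARel 1 k R (fun i => t1 (tnth gs i) v0).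
have /MTh/=/(_ p) : @Lall_sat standard_model 0 (AAll
    (AAnd (AImp T S) (AImp S T))) [tuple] by rewrite /=; split.
have -> : [tuple Lall_eval (t1 (tnth gs i) v0) [tuple of p :: [tuple]] | i < k] =
    [tuple mfun1 (tnth gs i) p | i < k].
  by apply: eq_from_tnth => i; rewrite !tnth_mktuple eval_t1.
by rewrite /S sat_r1; move=> [RS SR]; apply/propext; split.
Qed.

Lemma mktuple1 (T : Type) (F : 'I_1 -> T) : [tuple F i | i < 1] = [tuple F ord0].
Proof. by apply: eq_from_tnth => i; rewrite tnth_mktuple !ord1. Qed.

Lemma mktuple2 (T : Type) (F : 'I_2 -> T) :
  [tuple F i | i < 2] = [tuple F ord0; F ord_max].
Proof.
apply: eq_from_tnth => -[[|[|i]] lt_i] //;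
  by rewrite tnth_mktuple (tnth_nth (F ord0)) /=; congr F; apply: val_inj.
Qed.

Lemma mktuple3 (T : Type) (F : 'I_3 -> T) :
  [tuple F i | i < 3] = [tuple F ord0; F (@Ordinal 3 1 isT); F ord_max].
Proof.
apply: eq_from_tnth => -[[|[|[|i]]] lt_i] //;
  by rewrite tnth_mktuple (tnth_nth (F ord0)) /=; congr F; apply: val_inj.
Qed.

Lemma mfun1E f g p : mfun1 f (mfun1 g p) = mfun1 (fun j => f (g j)) p.
Proof.
have := interp_fun_param (sym1 f) [tuple g] p; rewrite mktuple1 => H; apply: etrans H _.
by congr mfun1; apply/funext => j; rewrite mktuple1.
Qed.

Lemma mfun2E f g h p :
  mfun2 f (mfun1 g p) (mfun1 h p) = mfun1 (fun j => f (g j) (h j)) p.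
Proof.
have := interp_fun_param (sym2 f) [tuple g; h] p; rewrite mktuple2 => H; apply: etrans H _.
by congr mfun1; apply/funext => j; rewrite mktuple2.
Qed.

Lemma mrel1E R g p : mrel1 R (mfun1 g p) = mrel1 (fun j => R (g j)) p.
Proof.
have := interp_rel_param (rsym1 R) [tuple g] p; rewrite mktuple1 => H; apply: etrans H _.
by congr mrel1; apply/funext => j; rewrite mktuple1.
Qed.

Lemma mrel2E R g h p :
  mrel2 R (mfun1 g p) (mfun1 h p) = mrel1 (fun j => R (g j) (h j)) p.
Proof.
have := interp_rel_param (rsym2 R) [tuple g; h] p; rewrite mktuple2 => H; apply: etrans H _.
by congr mrel1; apply/funext => j; rewrite mktuple2.
Qed.

Lemma stdE c p : std M c = mfun1 (fun=> c) p.
Proof.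
have := interp_fun_param (fun=> c) ([tuple] : 0.-tuple (nat -> nat)) p.
by rewrite /std => <-; congr interp_fun; apply: eq_from_tnth => -[].
Qed.

Lemma mfun1_eq f g p : (mfun1 f p = mfun1 g p) = mrel1 (fun j => f j = g j) p.
Proof.
have /MTh/=/(_ p) : @Lall_sat standard_model 0 (AAll (AAnd
    (AImp (AEq (t1 f v0) (t1 g v0)) (r1 (fun j => f j = g j) v0))
    (AImp (r1 (fun j => f j = g j) v0) (AEq (t1 f v0) (t1 g v0))))) [tuple].
  by rewrite /= => i; rewrite !sat_r1 !eval_t1; split.
by rewrite !sat_r1 !eval_t1 => -[? ?]; apply/propext.
Qed.

Lemma mfun1_id p : mfun1 id p = p.
Proof.
have /MTh/=/(_ p) : @Lall_sat standard_model 0 (AAll (AEq (t1 id v0) v0)) [tuple].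
  by rewrite /= => i; rewrite eval_t1.
by rewrite eval_t1.
Qed.

Lemma param2 x y : exists p f g, x = mfun1 f p /\ y = mfun1 g p.
Proof.
pose pr i j := CodeSeq.code [:: i; j].
exists (mfun2 pr x y), (seq_nth^~ 0), (seq_nth^~ 1).
have /MTh/=/(_ x y) : @Lall_sat standard_model 0 (AAll (AAll (AAnd
    (AEq (t1 (seq_nth^~ 0) (t2 pr v1 v0)) v1)
    (AEq (t1 (seq_nth^~ 1) (t2 pr v1 v0)) v0)))) [tuple].
  rewrite /= => i j; rewrite !eval_t1 !eval_t2.
  suff : seq_nth (pr i j) 0 = i /\ seq_nth (pr i j) 1 = j by [].
  by rewrite /seq_nth /pr CodeSeq.codeK.
by rewrite !eval_t1 !eval_t2 => -[].
Qed.

Lemma param3 x y z : exists p f g h, [/\ x = mfun1 f p, y = mfun1 g p & z = mfun1 h p].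
Proof.
have [p [f [g [-> ->]]]] := param2 x y; have [q [u [h [-> ->]]]] := param2 p z.
by exists q; do 3!eexists; rewrite !mfun1E.
Qed.

Lemma param4 x y z t : exists p f g h k,
  [/\ x = mfun1 f p, y = mfun1 g p, z = mfun1 h p & t = mfun1 k p].
Proof.
have [p [f [g [h [-> -> ->]]]]] := param3 x y z.
have [q [u [k [-> ->]]]] := param2 p t.
by exists q; do 4!eexists; rewrite !mfun1E.
Qed.

(** Normalizes a quantifier-free statement about values at [p] to the form
    [mrel1 A p]; constants are brought to that form by [stdE]. *)
Definition mE := (mfun1E, mfun2E, mrel1E, mrel2E, mfun1_eq).

Lemma nonstandard_ge c x : nonstandard x -> mle (std M c) x.
Proof.
move=> x_ns; elim: c => [|c]; rewrite /mle -(mfun1_id x) !(stdE _ x) !mE.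
  by apply: transfer.
move=> cx; have : ~ mrel1 (fun j => j = c) x.
  by move=> xc; apply: (x_ns c); rewrite (stdE _ x) -{1}(mfun1_id x) mE.
by rewrite -mrel1_not; move: cx; apply: mrel1_imp2 => i /=; lia.
Qed.

(** The hypothesis says that [f] tends to infinity.  Being nonstandard is not a
    relation symbol, so [f x] is compared with each standard [c] separately: the
    preimage of [c] has a standard bound, which [x] exceeds. *)
Lemma mfun1_nonstandard f x : (forall c, exists b, forall i, f i = c -> i < b) ->
  nonstandard x -> nonstandard (mfun1 f x).
Proof.
move=> fb x_ns c; rewrite (stdE _ x) mE => fc; have [b bP] := fb c.
have := nonstandard_ge b x_ns; rewrite /mle -(mfun1_id x) (stdE _ x) mE.
move=> bx; apply: (@mrel1_cst False x).
by move: fc bx; apply: mrel1_imp2 => i /bP; lia.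
Qed.

End Transfer.

(** * Coded sets and completeness of the algebra of events *)

Definition nat_sub (a b : nat) : Prop := forall x, nat_mem x a -> nat_mem x b.

Definition nat_setD (a b : nat) : nat :=
  set_code [set x | nat_mem x a /\ ~ nat_mem x b].

Definition nat_setU (a b : nat) : nat :=
  set_code [set x | nat_mem x a \/ nat_mem x b].

Lemma nat_setDP x a b : nat_mem x (nat_setD a b) <-> nat_mem x a /\ ~ nat_mem x b.
Proof. by apply: (@set_codeP _ a) => y [/nat_mem_lt]. Qed.

Lemma nat_setUP x a b : nat_mem x (nat_setU a b) <-> nat_mem x a \/ nat_mem x b.
Proof. by apply: (@set_codeP _ (a + b)) => y [] /nat_mem_lt; lia. Qed.

Lemma nat_card_setU a b :
  nat_card (nat_setU a b) = nat_card a + nat_card (nat_setD b a).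
Proof.
rewrite /nat_card -size_cat; apply: perm_size; apply: uniq_perm.
- by rewrite filter_uniq ?iota_uniq.
- rewrite cat_uniq !filter_uniq ?iota_uniq// andbT; apply/hasPn => x /=.
  rewrite !mem_nat_card => xba; apply/negP => xa.
  by have [_] := (nat_setDP x b a).1 xba; apply.
- move=> x; rewrite mem_cat !mem_nat_card; apply/idP/orP.
    move=> /(nat_setUP x a b).1; case: (pselect (nat_mem x a)); first by left.
    by move=> nxa [//|xb]; right; apply/(nat_setDP x b a).
  by case=> [xa|/(nat_setDP x b a).1[xb _]]; apply/(nat_setUP x a b); [left|right].
Qed.

Section InternalSets.
Variable M : Lall_structure.
Hypothesis MTh : models_true_arithmetic M.
Implicit Types (a b x : M).

Definition msub (a b : M) : Prop := mrel2 nat_sub a b.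
Definition msetD (a b : M) : M := mfun2 nat_setD a b.
Definition msetU (a b : M) : M := mfun2 nat_setU a b.

Lemma msubP a b : msub a b <-> forall x, mmem x a -> mmem x b.
Proof.
split=> [+ x|ab].
  have [p [f [g [h [-> -> ->]]]]] := param3 MTh x a b.
  by rewrite /msub /mmem !mE //; apply: mrel1_imp2 => // i; apply.
(* A Skolem function: an element of [i] outside [j], if there is one. *)
pose wit i j := xget 0 [set x | nat_mem x i /\ ~ nat_mem x j].
have := ab (mfun2 wit a b).
have [p [f [g [-> ->]]]] := param2 MTh a b.
rewrite /msub /mmem !mE // => abw; apply: contrapT; rewrite -mrel1_not // => nab.
have wP i j : ~ nat_sub i j -> nat_mem (wit i j) i /\ ~ nat_mem (wit i j) j.
  move=> nij; rewrite /wit; case: xgetP => [y _ //|no].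
  by case: nij => y yi; apply: contrapT => nyj; apply: (no y).
have : mrel1 (fun j => ~ nat_mem (wit (f j) (g j)) (g j)) p.
  by move: nab; apply: mrel1_imp => // i /wP[].
rewrite mrel1_not //; apply; apply: abw.
by move: nab; apply: mrel1_imp => // i /wP[].
Qed.

Lemma msetDP x a b : mmem x (msetD a b) <-> mmem x a /\ ~ mmem x b.
Proof.
have [p [f [g [h [-> -> ->]]]]] := param3 MTh x a b.
rewrite /mmem /msetD !mE // -mrel1_not // -mrel1_and //.
by apply: mrel1_iff => // i; apply: nat_setDP.
Qed.

Lemma msetUP x a b : mmem x (msetU a b) <-> mmem x a \/ mmem x b.
Proof.
have [p [f [g [h [-> -> ->]]]]] := param3 MTh x a b.
rewrite /mmem /msetU !mE // -mrel1_or //.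
by apply: mrel1_iff => // i; apply: nat_setUP.
Qed.

Lemma mcard_setU a b :
  mcard (msetU a b) = mfun2 addn (mcard a) (mcard (msetD b a)).
Proof.
have [p [f [g [-> ->]]]] := param2 MTh a b.
rewrite /mcard /msetU /msetD !mE //; apply: transfer => // i.
exact: nat_card_setU.
Qed.

Lemma mmul_card_sub a b (c : M) k : msub a b ->
  mlt (mfun2 muln (std M k) (mcard b)) c -> mlt (mfun2 muln (std M k) (mcard a)) c.
Proof.
have [p [f [g [h [-> -> ->]]]]] := param3 MTh a b c.
rewrite /mcard /msub /mlt (stdE MTh _ p) !mE //; apply: mrel1_imp2 => // i /nat_card_le ab.
by apply: leq_ltn_trans; rewrite leq_mul2l ab orbT.
Qed.

End InternalSets.

Section Completeness.
Variables (M : Lall_structure) (MTh : models_true_arithmetic M).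
Hypothesis Msat : aleph1_saturated M.
Variables (n : M) (n_ns : nonstandard n).
Local Notation B := (Balg MTh n_ns).
Local Notation Omega := (sample_space n).
Local Notation class := (event_class MTh n_ns).
Implicit Types (a b : M) (E F : event n).

Lemma class_le E F : (class E <= class F)%O <-> infinitesimal (sval E `\` sval F).
Proof.
rewrite leEmeet.
have -> : (class E `&` class F)%O = class (eventI MTh E F) by apply: BmeetE.
have <- : sval (eventI MTh E F) `+` sval E = sval E `\` sval F.
  apply/seteqP; split=> w; rewrite /setY /= /setI /setD /setU /mkset.
    by have [] := pselect (sval E w); have [] := pselect (sval F w); tauto.
  by tauto.
by split=> [/eqP/event_classE|H] //; apply/eqP/event_classE.
Qed.

Lemma coded_code a : coded [set w : sample n | mmem (sval w) a].
Proof.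
exists (msetD Omega (msetD Omega a)); apply/event_codeP; split=> [x /(msetDP MTh)[]//|w].
rewrite !(msetDP MTh) /mkset.
have := svalP w; have [] := pselect (mmem (sval w) a); tauto.
Qed.

Definition code_event a : event n := mkevent (coded_code a).

Lemma code_eventP E : exists2 a, msub a Omega & sval E = sval (code_event a).
Proof.
have [a aE] := event_coded E; exists a.
  by apply/(msubP MTh) => x /aE[w _ <-]; exact: (svalP w).
by apply/seteqP; split=> w /=; have := mmem_sval w aE => -[]; auto.
Qed.

Lemma class_codeP (b : B) : exists2 a, msub a Omega & b = class (code_event a).
Proof.
elim/event_classP: b => E; have [a aO aE] := code_eventP E; exists a => //.
exact: event_class_set.
Qed.

Lemma code_class_le a b : msub a Omega ->
  ((class (code_event a) <= class (code_event b))%O <->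
   infinitesimal_ratio (mcard (msetD a b)) (mcard Omega)).
Proof.
move=> /(msubP MTh) aO; rewrite class_le /=.
have abE : event_code (msetD a b) ([set w : sample n | mmem (sval w) a] `\`
    [set w | mmem (sval w) b]).
  apply/event_codeP; split=> [x /(msetDP MTh)[xa _]|w]; first exact: aO.
  by rewrite (msetDP MTh).
split=> [[c cE c0] k /c0|]; last by exists (msetD a b).
by apply: mmul_card_sub => //; apply/(msubP MTh) => x /abE/cE.
Qed.

Lemma code_classU a b :
  class (code_event (msetU a b)) = (class (code_event a) `|` class (code_event b))%O.
Proof.
rewrite [RHS](BjoinE MTh n_ns); apply: event_class_set => /=.
by apply/seteqP; split=> w /=; rewrite (msetUP MTh).
Qed.

Lemma Omega_gt0 : mlt (std M 0) (mcard Omega).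
Proof.
have := nonstandard_ge MTh 2 n_ns; rewrite -(mfun1_id MTh n) /Omega /mlt /mle /mcard.
rewrite /sample_space !(stdE MTh _ n) !mE //.
by apply: mrel1_imp => // i; apply: sample_space_gt0.
Qed.

Section Supremum.
Variable S : set B.

(** These events form an ideal with the same upper bounds as [S]; closure under
    unions, needed for the exhaustion below, then comes without finite joins. *)
Let below a := msub a Omega /\ forall u, ubound S u -> (class (code_event a) <= u)%O.

Let belowU a b : below a -> below b -> below (msetU a b).
Proof.
move=> [/(msubP MTh) aO aS] [/(msubP MTh) bO bS]; split.
  apply/(msubP MTh) => x /(msetUP MTh)[]; [exact: aO | exact: bO].
by move=> u uS; rewrite code_classU leUx aS//= bS.
Qed.

(** Let [q] be the largest number such that some member [a] of the ideal has
    probability at least [q / j].  A union of [a] with another member has probability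
    less than [(q + 1) / j], so it exceeds [a] by less than [1 / j]. *)
Let below_exhausting j : exists2 a, below a & forall b, below b ->
  mlt (mfun2 muln (std M j) (mcard (msetD b a))) (mcard Omega).
Proof.
pose P q := `[< exists2 a, below a &
  mle (mfun2 muln (std M q) (mcard Omega)) (mfun2 muln (std M j) (mcard a)) >].
have P0 : exists q, P q.
  have [a aP] := mset_empty MTh; exists 0; apply/asboolP; exists a.
    split; first by apply/(msubP MTh) => x /aP.
    move=> u _; apply: le_trans (le0x u).
    have [b bO ->] := class_codeP \bot%O; apply/code_class_le.
      by apply/(msubP MTh) => x /aP.
    move=> k k0; apply: mcard_empty => // x /(msetDP MTh)[/aP[]].
  have [p [f [g [-> ->]]]] := param2 MTh a n.
  rewrite /mle /sample_space /mcard !(stdE MTh _ p) !mE //; exact: transfer.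
have Pj q : P q -> q <= j.
  move=> /asboolP[a [aO _]]; move: aO Omega_gt0.
  have [p [f [g [-> ->]]]] := param2 MTh a n.
  rewrite /mle /mlt /msub /sample_space /mcard !(stdE MTh _ p) !mE // => aO N0 qj.
  apply: (@mrel1_cst M MTh _ p); move: aO N0 qj; apply: mrel1_imp3 => // i.
  move=> /nat_card_le; nia.
case: (ex_maxnP P0 Pj) => q /asboolP[a aD aq] q_max; exists a => // b bD.
have [//|nlt] := pselect (mlt (mfun2 muln (std M j) (mcard (msetD b a))) (mcard Omega)).
have : P q.+1.
  apply/asboolP; exists (msetU a b); first exact: belowU.
  move: aq nlt; rewrite mcard_setU //.
  have [p [f [g [h [-> -> ->]]]]] := param3 MTh a b n.
  rewrite /mle /mlt /sample_space /mcard /msetD !(stdE MTh _ p) !mE // -mrel1_not //.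
  by apply: mrel1_imp2 => // i; nia.
by move/q_max; lia.
Qed.

(** Take members [A j] of the ideal, increasing in [j], outside which every member
    has probability less than [1/j].  By saturation some coded event [x] contains
    all of them and exceeds [A j] by less than [1/j], for every standard [j].  Then
    [x] contains each member of the ideal up to an infinitesimal event, and an upper
    bound of [S] contains each [A j], hence [x], up to an infinitesimal event. *)
Lemma supremums_exist : supremums S !=set0.
Proof.
pose E j := s2val (cid2 (below_exhausting j)).
have ED j : below (E j) by rewrite /E; case: cid2.
have EP j b : below b -> mlt (mfun2 muln (std M j) (mcard (msetD b (E j)))) (mcard Omega).
  by rewrite /E; case: cid2 => a aD aP /=; apply: aP.
pose fix A j := if j is j'.+1 then msetU (A j') (E j) else E 0.
have AD j : below (A j) by elim: j => [|j IH] /=; [|apply: belowU].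
have EA j : msub (E j) (A j) by apply/(msubP MTh) => x; case: j => //= j xE; apply/(msetUP MTh); auto.
have AA i j : i <= j -> msub (A i) (A j).
  move/subnK <-; apply/(msubP MTh) => x; elim: (j - i) => //= m IH /IH.
  by move=> xA; apply/(msetUP MTh); auto.
have AP j b : below b -> mlt (mfun2 muln (std M j) (mcard (msetD b (A j)))) (mcard Omega).
  move=> bD; apply: mmul_card_sub (EP j b bD) => //; apply/(msubP MTh) => x.
  move=> /(msetDP MTh)[xb xA]; apply/(msetDP MTh); split=> // xE; apply: xA.
  by have /(msubP MTh) := EA j; apply.
pose phi j : Lall_formula 3 := AAnd (r2 nat_sub v1 v0) (AAnd (r2 nat_sub v0 v2)
  (r2 (fun x y => x < y) (t2 muln (tc _ j) (t1 nat_card (t2 nat_setD v0 v1)))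
     (t1 nat_card v2))).
pose typ j := @ParamFormula M 2 (phi j) [tuple A j; Omega].
have typP j x : realizes (typ j) x <-> [/\ msub (A j) x, msub x Omega &
    mlt (mfun2 muln (std M j) (mcard (msetD x (A j)))) (mcard Omega)].
  by rewrite /realizes /typ /phi /= !satE; split=> [[? []]|[]].
have [l|x xP] := Msat (p := typ).
  exists (A l) => i il; apply/typP; split; [exact: AA (ltnW il) | exact: (AD l).1 |].
  exact: AP.
have {}xP j := (typP j x).1 (xP j).
have [_ xO _] := xP 0.
exists (class (code_event x)); split=> [b Sb|u uS].
  have [c cO def_b] := class_codeP b; rewrite def_b; apply/code_class_le => // k k_gt0.
  have cD : below c by split=> // u; rewrite -def_b; apply.
  apply: mmul_card_sub (AP k c cD) => //; apply/(msubP MTh) => // y /(msetDP MTh)[yc nyx].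
  apply/(msetDP MTh); split=> // yA; apply: nyx; have [/(msubP MTh) xA _ _] := xP k.
  exact: xA.
have [c cO def_u] := class_codeP u; rewrite def_u; apply/code_class_le => // k k_gt0.
apply: (@mlt_card_union M MTh (msetD x (A (2 * k))) (msetD (A (2 * k)) c)).
- move=> y /(msetDP MTh)[yx nyc]; have [yA|nyA] := pselect (mmem y (A (2 * k))).
    by right; apply/(msetDP MTh).
  by left; apply/(msetDP MTh).
- by have [] := xP (2 * k).
- have := (AD (2 * k)).2 u uS; rewrite def_u => /code_class_le; apply; first exact: (AD _).1.
  by rewrite muln_gt0.
Qed.

End Supremum.

Lemma infimums_exist (S : set B) : infimums S !=set0.
Proof.
have [b [bub blb]] := supremums_exist (lbound S); exists b; split.
  by move=> x Sx; apply: blb => y; apply.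
by move=> y yS; apply: bub.
Qed.

End Completeness.

(** * The birthday bound for decision trees *)

Fixpoint tree_path (w : nat) (t : nat_tree) : seq nat :=
  match t with
  | GenTree.Leaf _ => [::]
  | GenTree.Node v ts => v :: nth [::] (map (tree_path w) ts) (nat_neighbor w v)
  end.

Definition clash (w : nat) (s : seq nat) : bool :=
  has (fun i => has (fun j => (i != j) && (nat_neighbor w i == nat_neighbor w j)) s) s.

Lemma clashP w s : reflect
  (exists i j, [/\ i \in s, j \in s, i <> j & nat_neighbor w i = nat_neighbor w j])
  (clash w s).
Proof.
apply: (iffP hasP) => [[i si /hasP[j sj /andP[/eqP ij /eqP nij]]]|[i [j [si sj ij nij]]]].
  by exists i, j.
by exists i => //; apply/hasP; exists j => //; rewrite nij eqxx andbT; apply/eqP.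
Qed.

Lemma eq_clash w s1 s2 : s1 =i s2 -> clash w s1 = clash w s2.
Proof.
by move=> s12; apply/clashP/clashP => -[i [j [si sj ij nij]]]; exists i, j;
  move: si sj; rewrite !s12.
Qed.

(** Sequential composition of decision trees. *)
Fixpoint tree_graft (F : nat -> nat_tree) (t : nat_tree) : nat_tree :=
  match t with
  | GenTree.Leaf x => F x
  | GenTree.Node v ts => GenTree.Node v (map (tree_graft F) ts)
  end.

Lemma tree_forall_nth (P : nat_tree -> Prop) ts x0 i :
  foldr (fun t => and (P t)) True ts -> i < size ts -> P (nth x0 ts i).
Proof. by elim: ts i => //= t ts IH [|i] [Pt Pts]// /IH; apply. Qed.

Lemma neighbor_tree_graft k F t : (forall x, neighbor_tree k (F x)) ->
  neighbor_tree k t -> neighbor_tree k (tree_graft F t).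
Proof.
move=> FP; elim: t => [x|v ts IH]//= /and3P[-> sz ts_k]; rewrite size_map sz /=.
move: ts_k IH {sz}; elim: ts => //= t ts IHt /andP[tk ts_k] [IH1 IH2].
by rewrite IH1//= IHt.
Qed.

Lemma tree_depth_nth t ts x0 v i : t = GenTree.Node v ts -> i < size ts ->
  tree_depth (nth x0 ts i) < tree_depth t.
Proof.
move=> -> lt_i /=; rewrite ltnS big_map.
by apply: (@leq_bigmax_seq _ _ xpredT tree_depth); rewrite ?mem_nth.
Qed.

Lemma tree_depth_graft F t d : (forall x, tree_depth (F x) <= d) ->
  tree_depth (tree_graft F t) <= tree_depth t + d.
Proof.
move=> FP; elim: t => [x|v ts IH]//=; rewrite addSn ltnS -map_comp big_map.
apply/bigmax_leqP_seq => t t_ts _ /=; rewrite -(nth_index t t_ts).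
have lt_i : index t ts < size ts by rewrite index_mem.
apply: leq_trans (tree_forall_nth t IH lt_i) _; rewrite leq_add2r.
by have := tree_depth_nth t (erefl (GenTree.Node v ts)) lt_i.
Qed.

Lemma tree_path_graft k w F t : (forall v, v < k -> nat_neighbor w v < k) ->
  neighbor_tree k t ->
  tree_path w (tree_graft F t) = tree_path w t ++ tree_path w (F (tree_run w t)).
Proof.
move=> wk; elim: t => [x|v ts IH]//= /and3P[vk /eqP sz /allP ts_k].
have lt_v : nat_neighbor w v < size ts by rewrite sz wk.
set x0 := GenTree.Leaf 0.
congr cons; rewrite -map_comp !(nth_map x0) //.
by apply: (tree_forall_nth x0 IH lt_v); apply: ts_k; rewrite mem_nth.
Qed.

Lemma nat_mem_inj a b : (forall x, nat_mem x a <-> nat_mem x b) -> a = b.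
Proof.
have shift x c : nat_mem x.+1 c = nat_mem x c./2.
  by rewrite /nat_mem expnS divnMA divn2.
have low c : nat_mem 0 c = odd c by rewrite /nat_mem expn0 divn1.
elim/ltn_ind: a b => a IH b ab.
have odd_ab : odd a = odd b by apply/idP/idP; have := ab 0; rewrite !low => -[].
have [a0|a_gt0] := posnP a.
  rewrite a0; apply/esym/eqP; rewrite -leqn0 leqNgt; apply/negP => b_gt0.
  have /andP[lo hi] := trunc_log_bounds (isT : 1 < 2) b_gt0.
  have : nat_mem (trunc_log 2 b) a.
    apply/ab; rewrite /nat_mem; suff -> : b %/ 2 ^ trunc_log 2 b = 1 by [].
    apply/eqP; rewrite eqn_leq -ltnS ltn_divLR ?expn_gt0// -expnS hi.
    by rewrite divn_gt0 ?expn_gt0.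
  by move/nat_mem_lt; rewrite a0.
rewrite -(odd_double_half a) -(odd_double_half b) odd_ab; congr (_ + _.*2).
by apply: IH => [|x]; [lia | rewrite -!shift].
Qed.

Lemma nat_pair_inj i j i' j' : nat_pair i j = nat_pair i' j' -> i = i' /\ j = j'.
Proof.
have lt s s' a b : a <= s -> s < s' -> 'C(s.+1, 2) + a < 'C(s'.+1, 2) + b.
  move=> le_a lt_s; have : 'C(s.+2, 2) <= 'C(s'.+1, 2) by apply: leq_bin2l.
  by rewrite [in 'C(s.+2, 2)]binS bin1; lia.
rewrite /nat_pair => eq_p; have [lt_s|lt_s|eq_s] := ltngtP (i + j) (i' + j').
- by have := lt _ _ j j' (leq_addl i j) lt_s; rewrite eq_p ltnn.
- by have := lt _ _ j' j (leq_addl i' j') lt_s; rewrite eq_p ltnn.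
- by move: eq_p; rewrite eq_s; lia.
Qed.

Section Birthday.
Variables k l : nat.
Implicit Types (f g : {ffun 'I_k -> 'I_l}) (A : {set {ffun 'I_k -> 'I_l}}).

Definition graph_code f : nat :=
  set_code [set e | exists i : 'I_k, e = nat_pair i (f i)].

Lemma graph_codeP f e : nat_mem e (graph_code f) <-> exists i : 'I_k, e = nat_pair i (f i).
Proof.
apply: (@set_codeP _ (nat_pair (k + l) (k + l))) => x [i ->].
by apply: nat_pair_lt; have := ltn_ord i; have := ltn_ord (f i); lia.
Qed.

Lemma graph_structureP w : graph_structure k l w <-> exists f, w = graph_code f.
Proof.
split=> [[f wP]|[f ->]]; last by exists f => e; apply: graph_codeP.
by exists f; apply: nat_mem_inj => e; rewrite wP graph_codeP.
Qed.

Lemma nat_neighbor_graph f (i : 'I_k) : nat_neighbor (graph_code f) i = f i.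
Proof.
rewrite /nat_neighbor; case: xgetP => [j _ /= /graph_codeP[i' /nat_pair_inj[]]|].
  by move=> /val_inj <-.
by move=> /(_ (f i)) []; apply/graph_codeP; exists i.
Qed.

Lemma graph_code_inj : injective graph_code.
Proof.
move=> f g fg; apply/ffunP => i; apply: val_inj.
by rewrite /= -!nat_neighbor_graph fg.
Qed.

Lemma nat_card_graphs c A :
  (forall w, nat_mem w c <-> exists2 f, f \in A & w = graph_code f) -> nat_card c = #|A|.
Proof.
move=> cP; rewrite cardE -(size_map graph_code); apply: perm_size; apply: uniq_perm.
- by rewrite filter_uniq ?iota_uniq.
- by rewrite map_inj_uniq ?enum_uniq//; apply: graph_code_inj.
move=> w; rewrite mem_nat_card; apply/idP/mapP => [/(cP w).1[f fA ->]|[f]].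
  by exists f; rewrite ?mem_enum.
by rewrite mem_enum => fA ->; apply/(cP _).2; exists f.
Qed.

Definition update f v u : {ffun 'I_k -> 'I_l} := [ffun i => if i == v then u else f i].

(** Nothing is known in [A] about the values off [S]: in this sense [A] is a union of
    events given by the answers to the queries in [S], and conditioning on [A] leaves
    the value at a fresh point uniform. *)
Definition free_off A (S : seq 'I_k) : Prop :=
  forall f v u, f \in A -> v \notin S -> update f v u \in A.

(** Overwriting the value at the fresh point [v] by an arbitrary [u] maps the pairs
    of an [f] with [f s = f v] and a [u] injectively into [A]: the overwritten value
    is still visible at [s]. *)
Lemma card_meet A S s v : free_off A S -> v \notin S -> s != v ->
  l * #|[set f in A | f s == f v]| <= #|A|.
Proof.
move=> AS vS sv; set C := [set f in A | f s == f v].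
have upd_inj : {in finset.setX C (finset.setT : {set 'I_l}) &, injective (fun x => update x.1 v x.2)}.
  move=> [f u] [g u'] /finset.setXP[/setIdP[_ /eqP fs] _] /finset.setXP[/setIdP[_ /eqP gs] _] /= fg.
  have := congr1 (fun h => fun_of_fin h v) fg; rewrite !ffunE eqxx => <-.
  congr pair; apply/ffunP => i; have [->|iv] := eqVneq i v.
    rewrite -fs -gs; have := congr1 (fun h => fun_of_fin h s) fg.
    by rewrite !ffunE (negPf sv).
  by have := congr1 (fun h => fun_of_fin h i) fg; rewrite !ffunE (negPf iv).
have <- : #|finset.setX C (finset.setT : {set 'I_l})| = l * #|C| by rewrite cardsX finset.cardsT card_ord mulnC.
rewrite -(card_in_imset upd_inj); apply: subset_leq_card; apply/fintype.subsetP => g.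
move=> /imsetP[[f u]] /finset.setXP[/setIdP[fA _] _] ->; apply: AS => //.
Qed.

Lemma card_meet_seq A S v : free_off A S -> v \notin S ->
  l * #|[set f in A | has (fun s => f s == f v) S]| <= size S * #|A|.
Proof.
move=> AS vS; have : {subset S <= S} by [].
elim: {-2}S => [|s T IH] sub /=.
  by rewrite mul0n leqn0 muln_eq0 cards_eq0; apply/orP; right; apply/eqP/setP => f; rewrite !inE andbF.
have sS : s \in S by apply: sub; rewrite mem_head.
have sv : s != v by apply: contraNneq vS => <-.
have -> : [set f in A | (f s == f v) || has (fun s => f s == f v) T] =
    [set f in A | f s == f v] :|: [set f in A | has (fun s => f s == f v) T].
  by apply/setP => f; rewrite !inE -andb_orr.
rewrite mulSn; apply: leq_trans (leq_mul (leqnn l) (leq_card_setU _ _)) _.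
rewrite mulnDr leq_add ?(card_meet AS)// IH// => x xT; apply: sub.
by rewrite inE xT orbT.
Qed.

Lemma card_fibers A (P : pred {ffun 'I_k -> 'I_l}) v :
  \sum_(u : 'I_l) #|[set f in A | (f v == u) && P f]| <= #|A|.
Proof.
rewrite -(sum1_card (mem A)) (partition_big (fun f => f v) xpredT)//=.
apply: leq_sum => u _; rewrite sum1dep_card; apply/subset_leq_card/fintype.subsetP => f.
by rewrite !inE => /and3P[-> -> _].
Qed.

(** A new query either meets one of the answers given so far, which costs at most
    [size S / l] by the previous lemmas, or gets a fresh answer [u].  In the second
    case the event splits according to [u], each piece [Au u] is again free off the
    queries made, and the induction hypothesis applies to the subtree chosen by [u].
    The induction is on the depth, which avoids the nested recursion on trees. *)
Lemma card_clash t d A S : neighbor_tree k t -> tree_depth t <= d ->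
  free_off A S -> (forall f, f \in A -> ~~ clash (graph_code f) (map val S)) ->
  l * #|[set f in A | clash (graph_code f)
                        (map val S ++ tree_path (graph_code f) t)]|
    <= d * (size S + d) * #|A|.
Proof.
elim: d t A S => [|d IH] [x|v ts] A S //=.
- move=> _ _ _ AS; rewrite mul0n leqn0 muln_eq0 cards_eq0; apply/orP; right.
  by apply/eqP/setP => f; rewrite !inE cats0; apply/andP => -[/AS/negP].
- move=> _ _ _ AS; rewrite [#|_|](_ : _ = 0) ?muln0//; apply/eqP; rewrite cards_eq0.
  by apply/eqP/setP => f; rewrite !inE cats0; apply/andP => -[/AS/negP].
move=> /and3P[vk /eqP sz /allP ts_k] depth_ts AS clashS; pose v' := Ordinal vk.
pose meets f := has (fun s => (s != v') && (f s == f v')) S.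
pose Au u := [set f in A | (f v' == u) && ~~ meets f].
pose tu (u : 'I_l) := nth (GenTree.Leaf 0) ts u.
pose Bu u := [set f in Au u | clash (graph_code f)
   (map val (v' :: S) ++ tree_path (graph_code f) (tu u))].
set bad := [set f in A | _].
have bad_sub : bad \subset [set f in A | meets f] :|: \bigcup_u Bu u.
  apply/fintype.subsetP => f /setIdP[fA f_clash]; rewrite !inE fA /=.
  case m_f: (meets f) => //=; apply/bigcupP; exists (f v') => //.
  rewrite !inE fA eqxx m_f /=; move: f_clash.
  rewrite (nat_neighbor_graph f v') (_ : nth _ _ _ = tree_path (graph_code f) (tu (f v'))).
    by rewrite (@eq_clash _ _ (v :: map val S ++ tree_path (graph_code f) (tu (f v'))))//;
      move=> x; rewrite !(mem_cat, inE); do !case: (_ \in _); do !case: (_ == _).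
  have [lt_f|ge_f] := ltnP (f v') (size ts); first by rewrite (nth_map (GenTree.Leaf 0)).
  by rewrite /tu !nth_default ?size_map.
(* [v'] itself may occur in [S]; then it meets nothing, as [S] has no clash. *)
have card_meets : l * #|[set f in A | meets f]| <= size S * #|A|.
  have [vS|vS] := boolP (v' \in S); last first.
    rewrite (leq_trans _ (card_meet_seq AS vS))// leq_mul2l; apply/orP; right.
    apply/subset_leq_card/fintype.subsetP => f; rewrite !inE => /andP[-> /hasP[s sS /andP[_ fs]]].
    by apply/hasP; exists s.
  rewrite [#|_|](_ : _ = 0) ?muln0//; apply/eqP; rewrite cards_eq0.
  apply/eqP/setP => f; rewrite !inE; apply/andP => -[fA /hasP[s sS /andP[sv /eqP fs]]].
  have /negP := clashS f fA; apply; apply/clashP; exists (val s), (val v').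
  rewrite !map_f//; split=> //; first by move/val_inj/eqP; rewrite (negPf sv).
  by rewrite !nat_neighbor_graph fs.
have card_Bu u : l * #|Bu u| <= d * (size S + d.+1) * #|Au u|.
  have := IH (tu u) (Au u) (v' :: S); rewrite /= addSnnS; apply.
  - have [lt_u|ge_u] := ltnP u (size ts); last by rewrite /tu nth_default.
    by apply: ts_k; rewrite mem_nth.
  - have [lt_u|ge_u] := ltnP u (size ts); last by rewrite /tu nth_default.
    rewrite -ltnS; apply: leq_trans depth_ts.
    exact: (@tree_depth_nth _ ts _ v _ (erefl _)).
  - move=> f x y; rewrite !inE => /and3P[fA /eqP fv nm]; rewrite negb_or => /andP[xv xS].
    rewrite AS//= !ffunE [v' == x]eq_sym (negPf xv) fv eqxx /=.
    apply: contra nm => /hasP[s sS]; rewrite !ffunE [v' == x]eq_sym (negPf xv).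
    rewrite (negPf (_ : s != x)); last by apply: contraNneq xS => <-.
    by move=> sP; apply/hasP; exists s; rewrite // fv.
  move=> f; rewrite !inE => /and3P[fA _]; apply: contra => /clashP[i [j [iS jS ij nij]]].
  move: iS jS; rewrite !inE.
  have vP j' : j' \in map val S -> nat_neighbor (graph_code f) j' = f v' ->
      j' <> v -> meets f.
    move=> /mapP[r rS ->]; rewrite nat_neighbor_graph => fr rv.
    have {}fr : f r = f v' by apply: val_inj.
    apply/hasP; exists r => //; rewrite fr eqxx andbT.
    by apply/eqP => rv'; apply: rv; rewrite rv'.
  case/orP=> [/eqP i_v|iS]; case/orP=> [/eqP j_v|jS].
  - by case: ij; rewrite i_v j_v.
  - apply: (vP j) => // [|jv]; last by apply: ij; rewrite i_v jv.
    by rewrite -nij i_v; apply: (nat_neighbor_graph f v').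
  - apply: (vP i) => // [|iv]; last by apply: ij; rewrite j_v iv.
    by rewrite nij j_v; apply: (nat_neighbor_graph f v').
  have /negP := clashS f fA; case; apply/clashP; by exists i, j.
apply: leq_trans (leq_mul (leqnn l) (subset_leq_card bad_sub)) _.
apply: leq_trans (leq_mul (leqnn l) (leq_card_setU _ _)) _; rewrite mulnDr.
have : l * #|(\bigcup_u Bu u)%SET| <= d * (size S + d.+1) * #|A|.
  apply: (@leq_trans (l * \sum_u #|Bu u|)).
    rewrite leq_mul2l; apply/orP; right.
    elim/big_rec2: _ => [|u m B _ le_m]; first by rewrite cards0.
    by apply: leq_trans (leq_card_setU _ _) _; rewrite leq_add2l.
  rewrite big_distrr /=; apply: leq_trans; first by apply: leq_sum => u _; apply: card_Bu.
  by rewrite -big_distrr leq_mul2l card_fibers orbT.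
move=> card_B; rewrite mulSn mulnDl leq_add//; apply: leq_trans card_meets _.
by rewrite leq_mul2r leq_addr orbT.
Qed.

End Birthday.

Definition collision (k c1 c2 w : nat) : Prop :=
  let x1 := tree_run_code c1 w in let x2 := tree_run_code c2 w in
  [/\ x1 < k, x2 < k, x1 <> x2 & nat_neighbor w x1 = nat_neighbor w x2].

Definition collision_code (k c1 c2 : nat) : nat :=
  set_code [set w | nat_mem w (sample_space_code k) /\ collision k c1 c2 w].

Lemma collision_codeP k c1 c2 w : nat_mem w (collision_code k c1 c2) <->
  nat_mem w (sample_space_code k) /\ collision k c1 c2 w.
Proof. by apply: (@set_codeP _ (sample_space_code k)) => v [/nat_mem_lt]. Qed.

Lemma nat_neighbor_lt k w v : nat_mem w (sample_space_code k) -> v < k ->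
  nat_neighbor w v < k./2.
Proof.
move=> /sample_space_codeP/graph_structureP[f ->] vk.
by rewrite (nat_neighbor_graph f (Ordinal vk)).
Qed.

Definition probe (k x1 x2 : nat) : nat_tree :=
  if (x1 < k) && (x2 < k) then
    GenTree.Node x1 (nseq k (GenTree.Node x2 (nseq k (GenTree.Leaf 0))))
  else GenTree.Leaf 0.

(** Runs both trees and then queries their outputs, so that a collision they find
    shows up as a clash on the path. *)
Definition probing_tree (k : nat) (t1 t2 : nat_tree) : nat_tree :=
  tree_graft (fun x1 => tree_graft (fun x2 => probe k x1 x2) t2) t1.

Lemma neighbor_tree_probe k x1 x2 : neighbor_tree k (probe k x1 x2).
Proof.
rewrite /probe; case: ifP => // /andP[x1k x2k] /=.
by rewrite x1k size_nseq eqxx all_nseq /= x2k size_nseq eqxx all_nseq orbT orbT.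
Qed.

Lemma tree_depth_probe k x1 x2 : tree_depth (probe k x1 x2) <= 2.
Proof.
rewrite /probe; case: ifP => //= _; rewrite ltnS big_map.
apply/bigmax_leqP_seq => _ /nseqP[-> _] _ /=; rewrite ltnS big_map.
by apply/bigmax_leqP_seq => _ /nseqP[-> _] _.
Qed.

Lemma neighbor_probing_tree k t1 t2 : neighbor_tree k t1 -> neighbor_tree k t2 ->
  neighbor_tree k (probing_tree k t1 t2).
Proof.
move=> t1k t2k; apply: neighbor_tree_graft t1k => x1.
by apply: neighbor_tree_graft t2k => x2; apply: neighbor_tree_probe.
Qed.

Lemma tree_depth_probing_tree k t1 t2 :
  tree_depth (probing_tree k t1 t2) <= tree_depth t1 + (tree_depth t2 + 2).
Proof.
apply: tree_depth_graft => x1; apply: tree_depth_graft => x2.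
exact: tree_depth_probe.
Qed.

Lemma clash_probing_tree k w t1 t2 : nat_mem w (sample_space_code k) ->
  neighbor_tree k t1 -> neighbor_tree k t2 ->
  tree_run w t1 < k -> tree_run w t2 < k -> tree_run w t1 <> tree_run w t2 ->
  nat_neighbor w (tree_run w t1) = nat_neighbor w (tree_run w t2) ->
  clash w (tree_path w (probing_tree k t1 t2)).
Proof.
move=> wk t1k t2k x1k x2k ne eq_nb.
have nb_lt v : v < k -> nat_neighbor w v < k.
  by move=> vk; have := nat_neighbor_lt wk vk; lia.
rewrite /probing_tree (tree_path_graft _ nb_lt t1k) (tree_path_graft _ nb_lt t2k).
rewrite /probe x1k x2k /= map_nseq nth_nseq nb_lt//= .
by apply/clashP; do 2!eexists; split; [| |exact: ne|exact: eq_nb];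
  rewrite !mem_cat !inE eqxx ?orbT.
Qed.

Lemma collision_bound k c1 c2 :
  neighbor_tree_code k c1 -> neighbor_tree_code k c2 ->
  let d := tree_depth_code c1 + (tree_depth_code c2 + 2) in
  k./2 * nat_card (collision_code k c1 c2) <= d * d * nat_card (sample_space_code k).
Proof.
rewrite /neighbor_tree_code /tree_depth_code.
case def_t1: (tree_of_code c1) => [t1|//]; case def_t2: (tree_of_code c2) => [t2|//] /=.
move=> t1k t2k; set d := _ + _; pose t := probing_tree k t1 t2.
have codeE c w s : tree_of_code c = Some s -> tree_run_code c w = tree_run w s.
  by rewrite /tree_run_code => ->.
have -> : nat_card (sample_space_code k) = #|finset.setT : {set {ffun 'I_k -> 'I_k./2}}|.
  apply: nat_card_graphs => w; split=> [/sample_space_codeP/graph_structureP[f ->]|[f _ ->]].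
    by exists f; rewrite ?inE.
  by apply/sample_space_codeP/graph_structureP; exists f.
pose C : {set {ffun 'I_k -> 'I_k./2}} :=
  finset (fun f => `[< collision k c1 c2 (graph_code f) >]).
rewrite (@nat_card_graphs k k./2 _ C); last first.
  move=> w; split=> [/collision_codeP[/sample_space_codeP/graph_structureP[f ->] col]|].
    by exists f; rewrite ?inE//; apply/asboolP.
  move=> [f]; rewrite inE => /asboolP col ->; apply/collision_codeP; split=> //.
  by apply/sample_space_codeP/graph_structureP; exists f.
have := @card_clash k k./2 t d finset.setT [::] (neighbor_probing_tree t1k t2k)
  (tree_depth_probing_tree k t1 t2); rewrite add0n => bound.
apply: leq_trans (bound _ _) => [|f v u _ _|//]; last by rewrite inE.
rewrite leq_mul2l; apply/orP; right; apply/subset_leq_card/fintype.subsetP => f.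
rewrite !inE /= /collision !(codeE _ _ _ def_t1) !(codeE _ _ _ def_t2).
case; apply: clash_probing_tree => //.
by apply/sample_space_codeP/graph_structureP; exists f.
Qed.

(** Two trees of depth at most [k ^ (1/4)] make [O(k ^ (1/4))] queries together, so
    the bound above is [O(k ^ (-1/2))].  The last hypothesis makes it less than [1/s]:
    with [r] the maximum of [1] and the depths, so that [r ^ 4 <= k], there are at
    most [4 * r] queries, and [34 * s.+1 * r ^ 2 <= k] holds because the square of
    the larger factor is at most [k]. *)
Lemma collision_rare s k c1 c2 :
  neighbor_tree_code k c1 -> neighbor_tree_code k c2 ->
  tree_depth_code c1 ^ 4 <= k -> tree_depth_code c2 ^ 4 <= k -> (34 * s.+1) ^ 2 <= k ->
  s * nat_card (collision_code k c1 c2) < nat_card (sample_space_code k).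
Proof.
move=> c1k c2k; have := collision_bound c1k c2k.
move: (tree_depth_code c1) (tree_depth_code c2) => d1 d2 /= bound d1k d2k k_ge.
have : 0 < nat_card (sample_space_code k) by apply: sample_space_gt0; nia.
have : s * ((d1 + (d2 + 2)) * (d1 + (d2 + 2))) < k./2.
  pose r := maxn 1 (maxn d1 d2).
  have r4 : r ^ 2 * r ^ 2 <= k.
    rewrite -expnD; have [->|[->|->]] // : r = 1 \/ r = d1 \/ r = d2; first by rewrite /r; lia.
    by rewrite exp1n; apply: leq_trans k_ge; rewrite expn_gt0.
  have r2_gt0 : 0 < r ^ 2 by rewrite expn_gt0 /r; lia.
  have d_le : (d1 + (d2 + 2)) * (d1 + (d2 + 2)) <= 16 * r ^ 2.
    have : d1 + (d2 + 2) <= 4 * r by rewrite /r; lia.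
    by move: (d1 + _) r {r4 r2_gt0} => d r; rewrite -mulnn; nia.
  suff : 34 * s.+1 * r ^ 2 <= k by move: (r ^ 2) (_ * _) r2_gt0 d_le => a b; nia.
  move: (r ^ 2) r4 k_ge => a aa; rewrite -mulnn.
  by have [] := leqP a (34 * s.+1); nia.
move=> sD N_gt0; have half_gt0 : 0 < k./2 by apply: leq_ltn_trans sD.
rewrite -(ltn_pmul2l half_gt0) mulnCA; apply: leq_ltn_trans (leq_mul (leqnn s) bound) _.
by rewrite mulnA ltn_pmul2r.
Qed.

(** * Roots, bit lengths, query trees and codes of finite functions *)

Lemma nat_root_le k t : 0 < t -> nat_root k t ^ t <= k.
Proof.
move=> t_gt0; rewrite /nat_root; elim/big_ind: _ => //; first by rewrite exp0n.
by move=> x y xk yk; rewrite /maxn; case: ifP.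
Qed.

Lemma leq_nat_root r k t : 0 < t -> r ^ t <= k -> r <= nat_root k t.
Proof.
move=> t_gt0 rk; have r_lt : r < k.+1.
  have [->//|r_gt0] := posnP r; rewrite ltnS; apply: leq_trans rk.
  by rewrite -{1}(expn1 r) leq_pexp2l.
exact: (@leq_bigmax_cond _ _ (fun r : 'I_k.+1 => r : nat) (Ordinal r_lt)).
Qed.

Lemma expn4_nat_root d k t : 4 <= t -> d <= nat_root k t -> d ^ 4 <= k.
Proof.
move=> t_ge4 d_le; have [->//|d_gt0] := posnP d.
have t_gt0 : 0 < t by lia.
apply: leq_trans (nat_root_le k t_gt0); apply: (@leq_trans (d ^ t)).
  by rewrite leq_pexp2l.
by rewrite leq_exp2r.
Qed.

(** For [t] about [log log k], the power [(log k) ^ t] is about [2 ^ (t ^ 2)] and so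
    still below [2 ^ (2 ^ t)], which is about [k]. *)
Lemma leq_exp_nat_root k (t := trunc_log 2 (up_log 2 k)) : 5 <= t ->
  k <= 2 ^ nat_root k t.
Proof.
move=> t_ge5; apply: leq_trans (up_logP k (isT : 1 < 2)) _; rewrite leq_exp2l//.
have e_gt0 : 0 < up_log 2 k by apply: contraTT t_ge5; rewrite -eqn0Ngt /t => /eqP->.
have /andP[lo hi] := trunc_log_bounds (isT : 1 < 2) e_gt0; rewrite -/t in lo hi.
have k_gt1 : 1 < k by move: e_gt0; case: (k) => [|[|]]; rewrite ?up_log0 ?up_log1.
have /andP[k_lo _] := up_log_bounds (isT : 1 < 2) k_gt1.
apply: leq_nat_root; first by lia.
apply: leq_trans (ltnW k_lo); apply: (@leq_trans ((2 ^ t.+1) ^ t)).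
  by rewrite leq_exp2r ?(ltnW hi)//; lia.
rewrite -expnM leq_exp2l// -ltnS prednK//; apply: leq_trans lo.
elim: t t_ge5 {hi} => // t IH; rewrite leq_eqVlt => /orP[/eqP <-//|].
rewrite ltnS => t_ge5; have := IH t_ge5; rewrite [2 ^ t.+1]expnS; nia.
Qed.

Lemma bit_length_pow2 e : bit_length (2 ^ e) = e.+1.
Proof.
apply: up_log_eq => //; rewrite ltnSn /= expnS.
by have := expn_gt0 2 e; lia.
Qed.

Lemma lt_pow2_of_bit_length x e : bit_length x < bit_length (2 ^ e) -> x < 2 ^ e.
Proof.
apply: contraTT; rewrite -!leqNgt => le_x.
by rewrite /bit_length leq_up_log.
Qed.

Lemma bit_length_half j e : j < (2 ^ e)./2 -> bit_length j < bit_length (2 ^ e) - 1.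
Proof.
rewrite bit_length_pow2 subn1 /=; case: e => [|e] //.
by rewrite expnS mul2n doubleK ltnS => j_lt; apply: up_log_min.
Qed.

Lemma tree_of_pickle (t : nat_tree) : tree_of_code (pickle t) = Some t.
Proof. exact: pickleK. Qed.

Definition query_tree (k v : nat) : nat_tree :=
  GenTree.Node v [seq GenTree.Leaf u | u <- iota 0 k].

Lemma neighbor_query_tree k v : v < k -> neighbor_tree k (query_tree k v).
Proof.
move=> vk /=; rewrite vk size_map size_iota eqxx.
by apply/allP => _ /mapP[u _ ->].
Qed.

Lemma tree_depth_query k v : tree_depth (query_tree k v) <= 1.
Proof.
rewrite /= ltnS -map_comp big_map; apply/bigmax_leqP_seq => u _ _ //.
Qed.

Lemma tree_leaves_query k v x : x \in tree_leaves (query_tree k v) -> x < k.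
Proof.
rewrite /= -map_comp => /flattenP[_ /mapP[u u_k ->]].
by rewrite inE => /eqP ->; move: u_k; rewrite mem_iota.
Qed.

Lemma tree_run_query k v w : nat_neighbor w v < k ->
  tree_run w (query_tree k v) = nat_neighbor w v.
Proof.
move=> lt_k; rewrite /= -map_comp (nth_map 0) ?size_iota//= .
by rewrite nth_iota.
Qed.

Definition fun_app1 (c x : nat) : nat := fun_app c [:: x].

(** Follows the coding of unary partial functions by the set of the codes of their
    argument-value sequences. *)
Definition fun1_code (D : set nat) (d : nat -> nat) : nat :=
  set_code [set e | exists2 x, D x & e = CodeSeq.code [:: x; d x]].

Lemma fun1_codeP (D : set nat) (d : nat -> nat) N e : (forall x, D x -> x < N) ->
  nat_mem e (fun1_code D d) <-> exists2 x, D x & e = CodeSeq.code [:: x; d x].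
Proof.
move=> DN; apply: (@set_codeP _ (\max_(x < N) CodeSeq.code [:: val x; d x]).+1).
move=> _ [x Dx ->]; rewrite ltnS.
exact: (@leq_bigmax _ (fun x : 'I_N => CodeSeq.code [:: val x; d x]) (Ordinal (DN x Dx))).
Qed.

Lemma mem_fun1_code (D : set nat) (d : nat -> nat) N s y : (forall x, D x -> x < N) ->
  nat_mem (CodeSeq.code (rcons s y)) (fun1_code D d) <->
  exists x, [/\ D x, s = [:: x] & y = d x].
Proof.
move=> DN; rewrite (fun1_codeP _ _ DN); split=> [[x Dx /(can_inj CodeSeq.codeK)]|].
  by rewrite -[[:: x; _]]/(rcons [:: x] (d x)) => /rcons_inj[-> ->]; exists x.
by case=> x [Dx -> ->]; exists x.
Qed.

Lemma fun_app1_code (D : set nat) (d : nat -> nat) N x : (forall x, D x -> x < N) ->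
  fun_app1 (fun1_code D d) x = if `[< D x >] then d x else 0.
Proof.
move=> DN; rewrite /fun_app1 /fun_app; case: xgetP => [y _|no]; case: asboolP => //.
- by move=> Dx /(mem_fun1_code d [:: x] y DN)[x' [_ [->] ->]].
- by move=> nDx /(mem_fun1_code d [:: x] y DN)[x' [Dx' [xx'] _]]; case: nDx; rewrite xx'.
- by move=> Dx; case: (no (d x)); apply/(mem_fun1_code _ _ _ DN); exists x.
Qed.

Lemma fun1_code_is_fun (D : set nat) (d : nat -> nat) N : (forall x, D x -> x < N) ->
  fun_code 1 (fun1_code D d).
Proof.
move=> DN; split=> [e /(fun1_codeP _ _ DN)[x _ ->]|s y z]; first by rewrite CodeSeq.codeK.
by move=> /(mem_fun1_code _ _ _ DN)[x [_ -> ->]] /(mem_fun1_code _ _ _ DN)[x' [_ [->] ->]].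
Qed.

Definition neighbor_fun (k w : nat) : nat :=
  fun1_code [set i | i < k] (nat_neighbor w).

Definition evaluation_fun (k i : nat) : nat :=
  fun1_code [set w | nat_mem w (sample_space_code k)] (nat_neighbor ^~ i).

Definition evaluation_seq (k : nat) : nat := CodeSeq.code (mkseq (evaluation_fun k) k).

Lemma neighbor_fun_app k w i :
  fun_app1 (neighbor_fun k w) i = if i < k then nat_neighbor w i else 0.
Proof.
rewrite (@fun_app1_code _ _ k) //; congr (if _ then _ else _).
exact: asboolb.
Qed.

Lemma evaluation_fun_app k w i : nat_mem w (sample_space_code k) -> i < k ->
  fun_app1 (seq_nth (evaluation_seq k) i) w = nat_neighbor w i.
Proof.
move=> wk ik; rewrite /seq_nth CodeSeq.codeK nth_mkseq//.
rewrite (@fun_app1_code _ _ (sample_space_code k)); last by move=> x /nat_mem_lt.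
by case: asboolP.
Qed.

(** * The neighbor function as an element of the structure *)

Section Numbers.
Variables (M : Lall_structure) (MTh : models_true_arithmetic M).
Variables (n : M) (n_ns : nonstandard n).

(** The exponent [t] is [log log n], which is nonstandard. *)
Lemma Mn_n : Mn n n.
Proof.
pose f k := trunc_log 2 (up_log 2 k).
have f_ns : nonstandard (mfun1 f n).
  apply: (mfun1_nonstandard MTh) n_ns => c; exists (2 ^ (2 ^ c.+1)).+1 => k <-; rewrite ltnS.
  apply: leq_trans (up_logP k (isT : 1 < 2)) _; rewrite leq_exp2l//.
  have [->//|e_gt0] := posnP (up_log 2 k).
  by have /andP[_ /ltnW] := trunc_log_bounds (isT : 1 < 2) e_gt0.
exists (mfun1 f n) => //; have := nonstandard_ge MTh 5 f_ns.
rewrite -[X in mle X (mfun1 (expn 2) _)](mfun1_id MTh n).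
rewrite -[X in mfun2 nat_root X _](mfun1_id MTh n) /mle (stdE MTh _ n) !mE //.
by apply: mrel1_imp => // k; apply: leq_exp_nat_root.
Qed.

Lemma mlt_Mn x : mlt x n -> Mn n x.
Proof.
move=> x_n; apply: (Mn_le MTh _ Mn_n); move: x_n.
have [p [f [g [-> ->]]]] := param2 MTh x n.
by rewrite /mlt /mle !mE //; apply: mrel1_imp => // i; apply: ltnW.
Qed.

Lemma std1_le_root : mle (std M 1) (mfun2 nat_root n n).
Proof.
have := nonstandard_ge MTh 1 n_ns; rewrite -(mfun1_id MTh n) /mle !(stdE MTh _ n) !mE //.
by apply: mrel1_imp => // k k_gt0; apply: leq_nat_root; rewrite // exp1n.
Qed.

Definition const_tree (x : M) : M := mfun1 (fun i => pickle (GenTree.Leaf i)) x.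

Lemma Fnb_const (x : M) : Mn n x -> Fnb (fun _ : sample n => x).
Proof.
move=> xMn; exists (const_tree x); last first.
  move=> w; have [p [f [g [-> ->]]]] := param2 MTh x (sval w).
  rewrite /const_tree !mE //; apply: transfer => // i.
  by rewrite /tree_run_code tree_of_pickle.
split.
- have [p [f [g [-> ->]]]] := param2 MTh x n.
  rewrite /const_tree !mE //; apply: transfer => // i.
  by rewrite /neighbor_tree_code tree_of_pickle.
- move=> y; suff : mrel2 tree_leaf_code (const_tree x) y -> y = x by move=> /[apply] ->.
  have [p [f [g [-> ->]]]] := param2 MTh x y.
  rewrite /const_tree !mE //; apply: mrel1_imp => // i.
  by rewrite /tree_leaf_code tree_of_pickle /= inE => /eqP.
exists n => //; have [p [f [g [-> ->]]]] := param2 MTh x n.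
rewrite /const_tree /mle !mE //; apply: transfer => // i.
by rewrite /tree_depth_code tree_of_pickle.
Qed.

Lemma Fnb_neighbor (v : M) : mlt v n ->
  Fnb (fun w : sample n => mfun2 nat_neighbor (sval w) v).
Proof.
move=> vn; exists (mfun2 (fun k i => pickle (query_tree k i)) n v); last first.
  move=> w; move: vn (svalP w).
  have [p [f [g [h [-> -> ->]]]]] := param3 MTh v (sval w) n.
  rewrite /mlt /mmem /sample_space !mE //; apply: mrel1_imp2 => // i fh gh.
  rewrite /tree_run_code tree_of_pickle; apply/esym/tree_run_query.
  by have := nat_neighbor_lt gh fh; lia.
split.
- move: vn; have [p [f [g [-> ->]]]] := param2 MTh v n.
  rewrite /mlt !mE //; apply: mrel1_imp => // i.
  by rewrite /neighbor_tree_code tree_of_pickle; apply: neighbor_query_tree.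
- move=> y yl; apply: mlt_Mn; move: yl.
  have [p [f [g [h [-> -> ->]]]]] := param3 MTh v y n.
  rewrite /mlt !mE //; apply: mrel1_imp => // i.
  by rewrite /tree_leaf_code tree_of_pickle; apply: tree_leaves_query.
exists n => //; apply: (mle_trans MTh _ std1_le_root).
have [p [f [g [-> ->]]]] := param2 MTh v n.
rewrite /mle (stdE MTh _ p) !mE //; apply: transfer => // i.
by rewrite /tree_depth_code tree_of_pickle; apply: tree_depth_query.
Qed.

(** The only consequence of depth [n ^ (1 / t)] with nonstandard [t] that the
    birthday bound uses. *)
Definition shallow_tree (k c : nat) : Prop :=
  neighbor_tree_code k c /\ tree_depth_code c ^ 4 <= k.

Lemma Tnb_shallow T : Tnb n T -> mrel2 shallow_tree n T.
Proof.
move=> [nT _ [t t_ns]]; have := nonstandard_ge MTh 4 t_ns; move: nT.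
have [p [f [g [h [-> -> ->]]]]] := param3 MTh T t n.
rewrite /mle (stdE MTh _ p) !mE //; apply: mrel1_imp3 => // i nT t_ge4 d_le.
by split=> //; apply: expn4_nat_root t_ge4 d_le.
Qed.

(** For each standard [k] the birthday bound, transferred, makes the probability
    less than [1 / k], since [n] exceeds the threshold depending on [k]. *)
Lemma collision_infinitesimal T1 T2 : Tnb n T1 -> Tnb n T2 ->
  infinitesimal [set w : sample n |
    let x1 := mfun2 tree_run_code T1 (sval w) in
    let x2 := mfun2 tree_run_code T2 (sval w) in
    [/\ mlt x1 n, mlt x2 n, x1 <> x2
      & mfun2 nat_neighbor (sval w) x1 = mfun2 nat_neighbor (sval w) x2]].
Proof.
move=> /Tnb_shallow T1s /Tnb_shallow T2s.
have [p [f [g [h [def_T1 def_T2 def_n]]]]] := param3 MTh T1 T2 n.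
pose a := mfun1 (fun i => collision_code (h i) (f i) (g i)) p.
exists a; last first.
  move=> k k_gt0; have := nonstandard_ge MTh ((34 * k.+1) ^ 2) n_ns.
  move: T1s T2s; rewrite /a /mcard /mle /mlt /sample_space !(stdE MTh _ p).
  rewrite def_T1 def_T2 def_n !mE //; apply: mrel1_imp3 => // i [? ?] [? ?] ?.
  exact: collision_rare.
have aP x : mmem x a <-> mmem x (sample_space n) /\
    [/\ mlt (mfun2 tree_run_code T1 x) n, mlt (mfun2 tree_run_code T2 x) n,
       mfun2 tree_run_code T1 x <> mfun2 tree_run_code T2 x
     & mfun2 nat_neighbor x (mfun2 tree_run_code T1 x) =
       mfun2 nat_neighbor x (mfun2 tree_run_code T2 x)].
  rewrite /a def_T1 def_T2 def_n; have [q [u [v [-> ->]]]] := param2 MTh p x.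
  rewrite /mmem /mlt /sample_space !mE //.
  split=> [wa|[w1 [w2 w3 w4 w5]]].
    split; first by move: wa; apply: mrel1_imp => // i /collision_codeP[].
    split.
    - by move: wa; apply: mrel1_imp => // i /collision_codeP[_ []].
    - by move: wa; apply: mrel1_imp => // i /collision_codeP[_ []].
    - by rewrite -mrel1_not //; move: wa; apply: mrel1_imp => // i /collision_codeP[_ []].
    - by move: wa; apply: mrel1_imp => // i /collision_codeP[_ []].
  have : mrel1 (fun i => ((tree_run_code (f (u i)) (v i) < h (u i) /\
      tree_run_code (g (u i)) (v i) < h (u i)) /\
      ~ (tree_run_code (f (u i)) (v i) = tree_run_code (g (u i)) (v i))) /\
      (nat_neighbor (v i) (tree_run_code (f (u i)) (v i)) =
       nat_neighbor (v i) (tree_run_code (g (u i)) (v i)))) q.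
    by rewrite !mrel1_and // mrel1_not.
  by move: w1; apply: mrel1_imp2 => // i wi [[[? ?] ?] ?]; apply/collision_codeP.
apply/(event_codeP _ _); split=> [x /aP[]//|w]; rewrite aP /=; split=> [[]//|?].
by split=> //; apply: (svalP w).
Qed.

Lemma mapp1E (c x : M) : mapp c [tuple x] = mfun2 fun_app1 c x.
Proof.
rewrite /mapp /mfun2; have -> : @app_sym 1 = sym2 fun_app1.
  apply/funext => v; rewrite /app_sym /sym2 /fun_app1.
  by case: v => -[|x0 [|x1 [|x2 s]]].
by congr interp_fun; apply: val_inj.
Qed.

Lemma rapp1E (Theta : random_fun n) (alpha : random_var n) w :
  rapp Theta [tuple alpha] w = mfun2 fun_app1 (Theta w) (alpha w).
Proof. by rewrite /rapp -mapp1E; congr mapp; apply: val_inj. Qed.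

Definition neighbor_rf : random_fun n := fun w => mfun2 neighbor_fun n (sval w).

Lemma neighbor_rf_lt (alpha : random_var n) w : mlt (alpha w) n ->
  rapp neighbor_rf [tuple alpha] w = mfun2 nat_neighbor (sval w) (alpha w).
Proof.
rewrite rapp1E /neighbor_rf.
have [p [f [g [h [-> -> ->]]]]] := param3 MTh (alpha w) (sval w) n.
rewrite /mlt !mE //; apply: mrel1_imp => // i.
by rewrite neighbor_fun_app => ->.
Qed.

Lemma neighbor_rf_is_random_fun : is_random_fun 1 neighbor_rf.
Proof.
move=> w; rewrite /neighbor_rf; split.
  have [p [f [g [-> ->]]]] := param2 MTh (sval w) n; rewrite !mE //.
  by apply: transfer => // i; apply: (@fun1_code_is_fun _ _ (g i)).
move=> v; have -> : [tuple of mfun2 neighbor_fun n (sval w) :: v] =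
   [tuple mfun2 neighbor_fun n (sval w); tnth v ord0; tnth v ord_max].
  apply: eq_from_tnth => -[[|[|[|i]]] lt_i] //;
    rewrite !(tnth_nth (std M 0)) //=.
move=> vP; suff [lt0 lt1] : mlt (tnth v ord0) n /\ mlt (tnth v ord_max) n.
  move=> i; apply: mlt_Mn; case: i => -[|[|i]] // lt_i.
    by have -> : Ordinal lt_i = ord0 by apply: val_inj.
  by have -> : Ordinal lt_i = ord_max by apply: val_inj.
move: vP (svalP w).
have [p [f [g [h [u [-> -> -> ->]]]]]] := param4 MTh (tnth v ord0) (tnth v ord_max) (sval w) n.
rewrite /mlt /mmem /sample_space !mE // => vP wP.
have := interp_rel_param MTh (@graph_sym 2)
  [tuple (fun j => neighbor_fun (u j) (h j)); f; g] p.
rewrite mktuple3 => H; move: vP; rewrite [interp_rel _ _]H {H} => vP.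
rewrite -mrel1_and //; move: vP wP; apply: mrel1_imp2 => // i.
rewrite mktuple3 /graph_sym /= => vP wP; move: vP.
move/(@mem_fun1_code _ _ (u i) [:: f i] (g i)); case=> // x [/= xu [fx] ->]; rewrite fx; split=> //.
by have := nat_neighbor_lt wP xu; lia.
Qed.

(** The tuple [gamma] has as [i]-th entry the map from [w] to the neighbor of [i],
    computed by a tree with the single query [i]. *)
Lemma neighbor_rf_unary : unary_condition neighbor_rf.
Proof.
exists (mfun1 evaluation_seq n), n; split; first exact: Mn_n.
- rewrite -[RHS](mfun1_id MTh n) !mE //; apply: transfer => // k.
  by rewrite /seq_size CodeSeq.codeK size_mkseq.
- move=> i i_n; have := Fnb_neighbor i_n; congr Fnb; apply/funext => w.
  rewrite /component mapp1E; move: i_n (svalP w).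
  have [p [f [g [h [-> -> ->]]]]] := param3 MTh i (sval w) n.
  rewrite /mlt /mmem /sample_space !mE //; apply: mrel1_imp2 => // j fj gj.
  by rewrite evaluation_fun_app.
move=> alpha _ w; split=> [lt_n|].
  rewrite neighbor_rf_lt // /component mapp1E; move: lt_n (svalP w).
  have [p [f [g [h [-> -> ->]]]]] := param3 MTh (alpha w) (sval w) n.
  rewrite /mlt /mmem /sample_space !mE //; apply: mrel1_imp2 => // j fj gj.
  by rewrite evaluation_fun_app.
rewrite rapp1E /neighbor_rf.
have [p [f [g [h [-> -> ->]]]]] := param3 MTh (alpha w) (sval w) n.
rewrite /mlt !(stdE MTh _ p) !mE // -mrel1_not //; apply: mrel1_imp => // i /negP.
by rewrite neighbor_fun_app => /negPf ->.
Qed.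

Lemma Gnb_neighbor_rf : Gnb 1 neighbor_rf.
Proof. split; [exact: neighbor_rf_is_random_fun | exact: neighbor_rf_unary]. Qed.

End Numbers.

(** * Internal random variables *)

Section InternalVariables.
Variables (M : Lall_structure) (MTh : models_true_arithmetic M).
Variables (n : M).
Implicit Types alpha beta : random_var n.

(** These are the functions on the sample space that are coded in [M]; a symbol with
    one parameter is enough, as parameters can be paired. *)
Definition internal alpha : Prop :=
  exists f p, forall w, alpha w = mfun2 f p (sval w).

Lemma internal_Fnb alpha : Fnb alpha -> internal alpha.
Proof. by case=> T _ alphaE; exists tree_run_code, T. Qed.

Lemma internal_cst (c : M) : internal (fun=> c).
Proof.
exists (fun x _ => x), c => w; have [p [f [g [-> ->]]]] := param2 MTh c (sval w).
by rewrite !mE //; apply: transfer.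
Qed.

Lemma internal1 h alpha : internal alpha -> internal (fun w => mfun1 h (alpha w)).
Proof.
case=> f [p alphaE]; exists (fun i j => h (f i j)), p => w; rewrite alphaE.
by have [q [u [v [-> ->]]]] := param2 MTh p (sval w); rewrite !mfun2E // mfun1E.
Qed.

Lemma internal2 h alpha beta : internal alpha -> internal beta ->
  internal (fun w => mfun2 h (alpha w) (beta w)).
Proof.
case=> f [p alphaE] [g [q betaE]]; have [r [u [v [def_p def_q]]]] := param2 MTh p q.
exists (fun i j => h (f (u i) j) (g (v i) j)), r => w.
rewrite alphaE betaE def_p def_q.
have [s [u' [v' [-> ->]]]] := param2 MTh r (sval w).
by rewrite !mfun1E // !mfun2E // mfun2E.
Qed.

(** The pigeonhole formula has a truth value for every [X] thanks to this: by the
    unary condition, the value of [X] is read off a coded tuple. *)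
Lemma internal_rapp (Theta : random_fun n) alpha : unary_condition Theta -> Fnb alpha ->
  internal (rapp Theta [tuple alpha]).
Proof.
case=> g [m [_ _ _ ThetaP]] alphaF.
have [f [p alphaE]] := internal_Fnb alphaF.
have [r [a [b [c [def_p def_g def_m]]]]] := param3 MTh p g m.
exists (fun i w => if f (a i) w < c i then fun_app1 (seq_nth (b i) (f (a i) w)) w else 0), r.
move=> w; have := ThetaP alpha alphaF w.
rewrite /component mapp1E //; move: (rapp _ _ w) => y.
rewrite alphaE def_p def_g def_m.
have [s [u [v [-> ->]]]] := param2 MTh r (sval w).
rewrite (stdE MTh 0 s) /mlt !mE // -mrel1_not // => -[lt_m ge_m].
have [lt|] := pselect (mrel1 (fun j => f (a (u j)) (v j) < c (u j)) s).
  rewrite (lt_m lt) mfun1_eq //; move: lt; apply: mrel1_imp => // i lt.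
  by rewrite lt.
rewrite -mrel1_not // => nlt; rewrite (ge_m nlt) mfun1_eq //.
by move: nlt; apply: mrel1_imp => // i /negP/negPf ->.
Qed.

Lemma coded_mrel1 A alpha : internal alpha -> coded [set w | mrel1 A (alpha w)].
Proof.
case=> f [p alphaE]; pose F i o := set_code [set w | nat_mem w o /\ A (f i w)].
have FP i o w : nat_mem w (F i o) <-> nat_mem w o /\ A (f i w).
  by apply: (@set_codeP _ o) => x [/nat_mem_lt].
exists (mfun2 F p (sample_space n)).
have aP x : mmem x (mfun2 F p (sample_space n)) <->
    mmem x (sample_space n) /\ mrel1 A (mfun2 f p x).
  have [q [u [v [o [-> -> ->]]]]] := param3 MTh x p (sample_space n).
  by rewrite /mmem !mE // -mrel1_and //; apply: mrel1_iff.
apply/event_codeP; split=> [x /aP[]//|w]; rewrite aP /= alphaE.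
by split=> [[]//|Aw]; split=> //; apply: (svalP w).
Qed.

Lemma coded_mrel2 R alpha beta : internal alpha -> internal beta ->
  coded [set w | mrel2 R (alpha w) (beta w)].
Proof.
pose pr i j := CodeSeq.code [:: i; j].
move=> /internal2 /[apply] => /(_ pr).
move=> /(@coded_mrel1 (fun z => R (seq_nth z 0) (seq_nth z 1))); congr coded.
apply/seteqP; split=> w /=; have [p [f [g [-> ->]]]] := param2 MTh (alpha w) (beta w);
  by rewrite !mE //; apply: mrel1_imp => // i; rewrite /seq_nth /pr CodeSeq.codeK.
Qed.

Lemma coded_eq alpha beta : internal alpha -> internal beta ->
  coded [set w | alpha w = beta w].
Proof.
move=> /(@coded_mrel2 eq) /[apply]; congr coded.
apply/seteqP; split=> w /=; have [p [f [g [-> ->]]]] := param2 MTh (alpha w) (beta w);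
  by rewrite !mE.
Qed.

End InternalVariables.

(** * Truth values *)

Section TruthValues.
Variables (M : Lall_structure) (MTh : models_true_arithmetic M).
Variables (n : M) (n_ns : nonstandard n).
Local Notation B := (Balg MTh n_ns).
Local Notation truth := (@truth_value M n MTh n_ns).
Local Notation class := (event_class MTh n_ns).

(** For quantifier-free formulas the truth value is the class of the event that the
    formula holds pointwise; carrying that event along makes it available for
    estimates. *)
Definition truth_event k s (phi : L2_formula n k s) e E (A : set (sample n)) : Prop :=
  exists2 F : event n, sval F = A & truth phi e E (class F).

Section Connectives.
Variables (k : nat) (s : seq nat) (e : k.-tuple (random_var n)).
Variable E : (size s).-tuple (random_fun n).
Implicit Types (phi psi : L2_formula n k s) (t u : L2_term n k s).

(** Internality is included because the events of atomic formulas are coded only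
    for terms with internal values. *)
Definition denotes t (alpha : random_var n) : Prop :=
  L2_eval t e E = alpha /\ internal alpha.

Lemma denotes_var (i : 'I_k) alpha : Fnb alpha -> tnth e i = alpha ->
  denotes (L2Var n s i) alpha.
Proof. by move=> alphaF eq_alpha; split=> //; apply: internal_Fnb. Qed.

Lemma denotes_const c (c_Ln : in_Ln n (fun _ : 0.-tuple nat => c)) ts :
  denotes (@L2Fun M n k s _ _ c_Ln ts) (fun=> std M c).
Proof.
split; last exact: internal_cst.
apply/funext => w /=; rewrite /std; congr interp_fun.
by apply: eq_from_tnth => -[].
Qed.

Lemma denotes_fun1 f (f_Ln : in_Ln n (sym1 f)) t alpha : denotes t alpha ->
  denotes (L2Fun f_Ln (tnth [tuple t])) (fun w => mfun1 f (alpha w)).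
Proof.
case=> <- ti; split; last exact: internal1.
apply/funext => w /=; rewrite (mktuple_tnth (fun t => L2_eval t e E w)) /mfun1.
by congr interp_fun; apply: val_inj.
Qed.

Lemma denotes_fun2 f (f_Ln : in_Ln n (sym2 f)) t u alpha beta :
  denotes t alpha -> denotes u beta ->
  denotes (L2Fun f_Ln (tnth [tuple t; u])) (fun w => mfun2 f (alpha w) (beta w)).
Proof.
case=> <- ti [<- ui]; split; last exact: internal2.
apply/funext => w /=; rewrite (mktuple_tnth (fun t => L2_eval t e E w)) /mfun2.
by congr interp_fun; apply: val_inj.
Qed.

Lemma truth_event_eq t u alpha beta : denotes t alpha -> denotes u beta ->
  truth_event (L2Eq t u) e E [set w | alpha w = beta w].
Proof.
case=> <- ti [<- ui]; have Ac := coded_eq MTh ti ui.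
by exists (mkevent Ac) => //; exists (mkevent Ac).
Qed.

Lemma truth_event_rel2 (R : nat -> nat -> Prop) t u alpha beta :
  denotes t alpha -> denotes u beta ->
  truth_event (L2Rel (rsym2 R) (tnth [tuple t; u])) e E
    [set w | mrel2 R (alpha w) (beta w)].
Proof.
case=> <- ti [<- ui]; have Ac := coded_mrel2 MTh R ti ui.
exists (mkevent Ac) => //; exists (mkevent Ac) => //=.
apply/seteqP; split=> w /=; rewrite (mktuple_tnth (fun t => L2_eval t e E w)) /mrel2;
  by congr interp_rel; apply: val_inj.
Qed.

Lemma truth_event_not phi A : truth_event phi e E A ->
  truth_event (L2Not phi) e E (~` A).
Proof.
case=> F <- phiF; exists (eventC MTh F) => //; exists (class F) => //.
exact/esym/BcomplE.
Qed.

Lemma truth_event_and phi psi A A' : truth_event phi e E A ->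
  truth_event psi e E A' -> truth_event (L2And phi psi) e E (A `&` A').
Proof.
case=> F <- phiF [G <- psiG]; exists (eventI MTh F G); first by [].
by exists (class F), (class G); split=> //; apply/esym/BmeetE.
Qed.

Lemma truth_event_or phi psi A A' : truth_event phi e E A ->
  truth_event psi e E A' -> truth_event (L2Or phi psi) e E (A `|` A').
Proof.
case=> F <- phiF [G <- psiG]; exists (eventU MTh F G); first by [].
by exists (class F), (class G); split=> //; apply/esym/BjoinE.
Qed.

End Connectives.

Section Quantifiers.
Variables (k : nat) (s : seq nat) (e : k.-tuple (random_var n)).
Variable E : (size s).-tuple (random_fun n).

Let choose_values (T : Type) (D : set T) (P : T -> B -> Prop) :
  (forall x, D x -> exists b, P x b) -> exists c : T -> B, forall x, D x -> P x (c x).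
Proof.
move=> DP; have [x|c cP] := @choice T B (fun x b => D x -> P x b); last by exists c.
by have [/DP[b]|nDx] := pselect (D x); [exists b | exists \bot%O].
Qed.

Lemma truth_ex (Msat : aleph1_saturated M) (phi : L2_formula n k.+1 s) :
  (forall alpha, Fnb alpha -> exists b, truth phi [tuple of alpha :: e] E b) ->
  exists b, truth (L2Ex phi) e E b.
Proof.
move=> /choose_values[c cP].
have [b bP] := supremums_exist Msat [set c alpha | alpha in @Fnb M n].
by exists b; exists c.
Qed.

Lemma truth_ex_bot (phi : L2_formula n k.+1 s) :
  (forall alpha, Fnb alpha -> truth phi [tuple of alpha :: e] E \bot%O) ->
  truth (L2Ex phi) e E \bot%O.
Proof.
move=> phi_bot; exists (fun=> \bot%O) => //; split=> [_ [alpha _ <-]//|b _].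
exact: le0x.
Qed.

Let infimums_bot (S : set B) : S \bot%O -> infimums S \bot%O.
Proof. by move=> S0; split=> [b _|b]; [apply: le0x | apply]. Qed.

Lemma truth_all (Msat : aleph1_saturated M) (phi : L2_formula n k.+1 s) :
  (forall alpha, Fnb alpha -> exists b, truth phi [tuple of alpha :: e] E b) ->
  exists b, truth (L2All phi) e E b.
Proof.
move=> /choose_values[c cP].
have [b bP] := infimums_exist Msat [set c alpha | alpha in @Fnb M n].
by exists b; exists c.
Qed.

(** All instances must have truth values for the infimum to be defined, but one
    instance with value bottom determines it. *)
Lemma truth_all_bot (phi : L2_formula n k.+1 s) alpha0 :
  (forall alpha, Fnb alpha -> exists b, truth phi [tuple of alpha :: e] E b) ->
  Fnb alpha0 -> truth phi [tuple of alpha0 :: e] E \bot%O ->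
  truth (L2All phi) e E \bot%O.
Proof.
move=> /choose_values[c cP] a0 phi0; exists c => //; apply: infimums_bot.
by exists alpha0 => //; apply: truth_value_uniq (cP _ a0) phi0.
Qed.

Lemma truth_all_fun_bot j (phi : L2_formula n k (j.+1 :: s)) Theta0 :
  (forall Theta, Gnb j.+1 Theta -> exists b, truth phi e [tuple of Theta :: E] b) ->
  Gnb j.+1 Theta0 -> truth phi e [tuple of Theta0 :: E] \bot%O ->
  truth (L2AllFun phi) e E \bot%O.
Proof.
move=> /choose_values[c cP] T0 phi0; exists c => //; apply: infimums_bot.
by exists Theta0 => //; apply: truth_value_uniq (cP _ T0) phi0.
Qed.

End Quantifiers.

Lemma class_bot (F : event n) : infinitesimal (sval F) -> class F = \bot%O.
Proof. by move=> F0; apply/event_classE; rewrite setY0. Qed.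

Section WeakPigeon.
Variables (Theta : random_fun n) (m x1 x2 : random_var n).

Local Notation len := (mfun1 bit_length).

Definition weak_pigeon_event : set (sample n) :=
  let X x := rapp Theta [tuple x] in
  let len_m_pred w := mfun2 subn (len (m w)) (std M 1) in
  [set w | m w = std M 0] `|`
  (([set w | mlt (len (x1 w)) (len (m w))] `&` [set w | mlt (len (x2 w)) (len (m w))]) `&`
   (([set w | mrel2 (fun x y => x >= y) (len (X x1 w)) (len_m_pred w)] `|`
     [set w | mrel2 (fun x y => x >= y) (len (X x2 w)) (len_m_pred w)]) `|`
    (~` [set w | x1 w = x2 w] `&` [set w | X x1 w = X x2 w]))).

Lemma truth_event_weak_pigeon : unary_condition Theta -> Fnb m -> Fnb x1 -> Fnb x2 ->
  truth_event (phi_weak_pigeon MTh n_ns)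
    [tuple of x2 :: [tuple of x1 :: [tuple of m :: [tuple]]]]
    [tuple of Theta :: [tuple]] weak_pigeon_event.
Proof.
move=> ThetaU mF x1F x2F; set e := [tuple of x2 :: _]; set E := [tuple of Theta :: _].
pose den := @denotes 3 [:: 1] e E.
have d2 : den (L2Var n [:: 1] (@Ordinal 3 0 isT)) x2 by apply: denotes_var.
have d1 : den (L2Var n [:: 1] (@Ordinal 3 1 isT)) x1 by apply: denotes_var.
have dm : den (L2Var n [:: 1] (@Ordinal 3 2 isT)) m by apply: denotes_var.
have dX t x : den t x -> Fnb x ->
    den (@L2App M n 3 [:: 1] ord0 (tnth [tuple t])) (rapp Theta [tuple x]).
  case=> <- _ tF; split; last exact: internal_rapp.
  rewrite /=; congr rapp; apply: eq_from_tnth => i; rewrite tnth_mktuple.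
  by rewrite (ord1 i).
have dlen := fun t alpha => @denotes_fun1 3 [:: 1] e E _ (Ln_sym1 MTh bit_length_le) t alpha.
have dpred : den (L2sub MTh (L2len MTh (L2Var n [:: 1] (@Ordinal 3 2 isT)))
    (L2one MTh n_ns 3 [:: 1])) (fun w => mfun2 subn (len (m w)) (std M 1)).
  by apply: denotes_fun2; [apply: dlen | apply: denotes_const].
rewrite /weak_pigeon_event /phi_weak_pigeon /L2lt /L2ge /L2len.
apply: truth_event_or; last apply: truth_event_and.
- by apply: truth_event_eq dm _; apply: denotes_const.
- by apply: truth_event_and; apply: truth_event_rel2; apply: dlen.
apply: truth_event_or; first apply: truth_event_or; last apply: truth_event_and.
- by apply: truth_event_rel2 dpred; apply: dlen; apply: dX.
- by apply: truth_event_rel2 dpred; apply: dlen; apply: dX.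
- by apply: truth_event_not; apply: truth_event_eq.
- by apply: truth_event_eq; apply: dX.
Qed.

End WeakPigeon.

(** As [n] is a power of two, [|x| < |n|] means [x < n], while neighbors are less
    than [n / 2] and thus have at most [|n| - 2] digits.  Hence the formula can only
    hold where the two trees output a collision of [w]. *)
Lemma neighbor_rf_weak_pigeon x1 x2 : power_of_two n -> Fnb x1 -> Fnb x2 ->
  truth (phi_weak_pigeon MTh n_ns)
    [tuple of x2 :: [tuple of x1 :: [tuple of (fun _ : sample n => n) :: [tuple]]]]
    [tuple of @neighbor_rf M n :: [tuple]] \bot%O.
Proof.
move=> n_pow2 x1F x2F; have nF := Fnb_const MTh n_ns (Mn_n MTh n_ns).
have [F FE] := truth_event_weak_pigeon (neighbor_rf_unary MTh n_ns) nF x1F x2F.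
rewrite class_bot//; have [T1 T1s x1E] := x1F; have [T2 T2s x2E] := x2F.
apply: infinitesimalS (collision_infinitesimal MTh n_ns T1s T2s) _ => //.
  exact: event_coded.
have lt_n (x : M) : mlt (mfun1 bit_length x) (mfun1 bit_length n) -> mlt x n.
  move: n_pow2; have [p [f [g [-> ->]]]] := param2 MTh x n.
  rewrite /power_of_two /mlt !mE //; apply: mrel1_imp2 => // i [e ->].
  exact: lt_pow2_of_bit_length.
have small y x : mmem y (sample_space n) -> mlt x n -> ~ mrel2 (fun x y => x >= y)
    (mfun1 bit_length (mfun2 nat_neighbor y x))
    (mfun2 subn (mfun1 bit_length n) (std M 1)).
  move: n_pow2; have [p [f [g [h [-> -> ->]]]]] := param3 MTh y x n.
  rewrite /power_of_two /mlt /mmem /sample_space (stdE MTh _ p) !mE // -mrel1_not //.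
  apply: mrel1_imp3 => // i [e ge] fi gi; apply/negP; rewrite -ltnNge.
  by move: (nat_neighbor_lt fi gi); rewrite ge; apply: bit_length_half.
rewrite FE => w; rewrite /weak_pigeon_event /= -x1E -x2E.
case=> [n0|[[/lt_n lt1 /lt_n lt2]]]; first by case: (n_ns n0).
rewrite !neighbor_rf_lt//; case=> [[|]|[]//].
- by move=> ge; case: (small _ _ (svalP w) lt1 ge).
- by move=> ge; case: (small _ _ (svalP w) lt2 ge).
Qed.

End TruthValues.

Theorem theorem6p5 (M : Lall_structure) (MTh : models_true_arithmetic M)
  (Msat : aleph1_saturated M) (n : M) (n_ns : nonstandard n)
  (n_pow2 : power_of_two n) :
  truth_value (weak_pigeon MTh n_ns) [tuple] [tuple] (\bot : Balg MTh n_ns)%O.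
Proof.
apply: (@truth_all_fun_bot _ _ _ _ _ _ _ _ _ _ (@neighbor_rf M n)) => [Theta [_ ThetaU]||].
- apply: truth_all => // m mF; apply: truth_ex => // x1 x1F; apply: truth_ex => // x2 x2F.
  by have [F _ FP] := truth_event_weak_pigeon MTh n_ns ThetaU mF x1F x2F; eexists; apply: FP.
- exact: Gnb_neighbor_rf.
apply: (@truth_all_bot _ _ _ _ _ _ _ _ _ (fun _ : sample n => n)) => [m mF||].
- apply: truth_ex => // x1 x1F; apply: truth_ex => // x2 x2F.
  have [F _ FP] := truth_event_weak_pigeon MTh n_ns (neighbor_rf_unary MTh n_ns) mF x1F x2F.
  by eexists; apply: FP.
- exact: (Fnb_const MTh n_ns (Mn_n MTh n_ns)).
apply: truth_ex_bot => x1 x1F; apply: truth_ex_bot => x2 x2F.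
exact: neighbor_rf_weak_pigeon.
Qed.
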